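(* Let $d\ge2$. For each choice of $1\le r_j<\infty$ and $0<\gamma_j<\infty$, $1\le j\le d$, there are groups $\mathbb{G}_j\in\{\mathbb{T},\mathbb{R}\}$ (with Haar measure), a $\sigma$-finite measure space $(X,\mathrm{d}\mu)$ and linear operators $T_j:L^{r_j}(\mathbb{G}_j)\to\mathcal{M}(X)$ such that $$\int_X\prod_{j=1}^d|T_jf_j|^{\gamma_j}\,\mathrm{d}\mu\lesssim\prod_{j=1}^d\|f_j\|_{r_j}^{\gamma_j}\quad\text{for all } f_j\in L^{r_j}(\mathbb{G}_j),$$ and such that $$\Big\{(p_j)\in(0,\infty)^d:\ \sum_{j=1}^d\frac{\gamma_j}{p_j}=1\text{ and, for each }j,\ T_j:L^{r_j}\to L^{p_j}(\phi_j)\text{ boundedly for some nontrivial }\phi_j\Big\}$$ $$=\Big(\prod_{j=1}^dJ_{r_j,\gamma_j}\Big)\cap\Big\{(p_j)\in(0,\infty)^d:\ \sum_{j=1}^d\frac{\gamma_j}{p_j}=1\Big\}.$$ This set is nonempty if and only if we have $\sum_{j=1}^d\gamma_j/\min\{r_j,2\}<1$ when at least one $r_j<2$, and $\sum_{j=1}^d\gamma_j\le2$ when all $r_j\ge2$. When nonempty, this set equals $$\Big(\prod_{j:\,r_j<2}(0,r_j)\times\prod_{j:\,r_j\ge2}(0,2]\Big)\cap\Big\{(p_j)\in(0,\infty)^d:\ \sum_{j=1}^d\frac{\gamma_j}{p_j}=1\Big\}.$$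
   Context: $\mathcal{M}(X)$ is the class of measurable functions on $X$. For $1\le r<\infty$ and $0<\gamma<\infty$, $$J_{r,\gamma}:=\begin{cases}(0,\gamma]&\text{when }2\le\gamma<r\text{ or }\gamma\ge r,\\(0,2]&\text{when }\gamma<2\le r,\\(0,r)&\text{when }\gamma<r<2.\end{cases}$$ The symbol $\lesssim$ means that the inequality holds with some finite constant independent of the $f_j$. A weight $\phi$ on $X$ is a nonnegative measurable function, nontrivial if it is not a.e. zero; ''$T:L^r\to L^p(\phi)$ boundedly'' means that there is $C<\infty$ with $\left(\int_X|Tf|^p\phi\,\mathrm{d}\mu\right)^{1/p}\le C\|f\|_{L^r}$ for all $f\in L^r$. *)

(* Defs.v *)
From HB Require Import structures.
From mathcomp Require Import all_boot all_order all_algebra.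
From mathcomp Require Import all_classical all_reals all_analysis.
From mathcomp Require Import measurable_realfun.

Set Implicit Arguments.
Unset Strict Implicit.
Unset Printing Implicit Defensive.

Import Order.TTheory GRing.Theory Num.Theory.
Import numFieldNormedType.Exports.

Local Open Scope classical_set_scope.
Local Open Scope ring_scope.

(* The circle group R/Z, represented by its fundamental domain [0, 1[ with
   addition modulo 1. *)
Record torus (R : realType) := Torus {
  torus_val : R;
  torus_valP : (0 <= torus_val < 1) }.

Section torus_group.
Variable R : realType.

HB.instance Definition _ := [isSub for @torus_val R].
HB.instance Definition _ := [Choice of torus R by <:].

Definition fracpart (x : R) : R := x - (Num.floor x)%:~R.

Lemma fracpart_itv (x : R) : 0 <= fracpart x < 1.
Proof.
rewrite /fracpart subr_ge0 floor_le ltrBlDl.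
by have := floorD1_gt x; rewrite intrD.
Qed.

Definition torus_proj (x : R) : torus R := Torus (fracpart_itv x).

Lemma torus_proj_val (x : torus R) : torus_proj (torus_val x) = x.
Proof.
apply: val_inj => /=; rewrite /fracpart.
have /floor_def -> : (0%:~R : R) <= torus_val x < (0 + 1)%:~R.
  by rewrite add0r; exact: torus_valP.
by rewrite subr0.
Qed.

Lemma torus_projDz (x : R) (m : int) : torus_proj (x + m%:~R) = torus_proj x.
Proof.
apply: val_inj => /=; rewrite /fracpart floorDrz ?intr_int// intrKfloor.
by rewrite intrD opprD addrACA subrr addr0.
Qed.

Definition torus_add (x y : torus R) := torus_proj (torus_val x + torus_val y).
Definition torus_opp (x : torus R) := torus_proj (- torus_val x).

Lemma torus_projD (x y : R) :
  torus_proj (x + y) = torus_add (torus_proj x) (torus_proj y).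
Proof.
rewrite /torus_add /= /fracpart addrACA -opprD -intrD.
by rewrite -mulrNz torus_projDz.
Qed.

Lemma torus_addA : associative torus_add.
Proof.
move=> x y z; rewrite -{1}(torus_proj_val x) -{2}(torus_proj_val z).
by rewrite -!torus_projD addrA.
Qed.

Lemma torus_addC : commutative torus_add.
Proof. by move=> x y; rewrite /torus_add addrC. Qed.

Lemma torus_add0 : left_id (torus_proj 0) torus_add.
Proof.
by move=> x; rewrite -{1}(torus_proj_val x) -torus_projD add0r torus_proj_val.
Qed.

Lemma torus_addN : left_inverse (torus_proj 0) torus_opp torus_add.
Proof.
move=> x; rewrite -{2}(torus_proj_val x) -torus_projD.
by rewrite addNr.
Qed.

HB.instance Definition _ :=
  GRing.isZmodule.Build (torus R) torus_addA torus_addC torus_add0 torus_addN.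

HB.instance Definition _ := isPointed.Build (torus R) (torus_proj 0).

End torus_group.

Section torus_haar.
Variable R : realType.
Local Notation mu := (@lebesgue_measure R).

Definition torus_measurableType :=
  g_sigma_algebra_preimageType (@torus_val R : torus R -> measurableTypeR R).

Lemma measurable_fracpart : measurable_fun setT (@fracpart R).
Proof.
apply: measurable_funB => //; apply: nondecreasing_measurable => // x y xy.
by rewrite ler_int; exact: le_floor.
Qed.

Lemma measurable_torus_proj :
  measurable_fun setT (@torus_proj R : measurableTypeR R -> torus_measurableType).
Proof.
move=> _ _ [B mB <-]; rewrite !setTI.
by have := measurable_fracpart measurableT mB; rewrite setTI.
Qed.

Definition haar_torus : set torus_measurableType -> \bar R :=
  pushforward (mrestr mu (measurable_itv `[0, 1[))
    (@torus_proj R : measurableTypeR R -> torus_measurableType).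

Let measurable_proj_preimage (A : set torus_measurableType) :
  measurable A -> measurable (@torus_proj R @^-1` A : set (measurableTypeR R)).
Proof. by move=> mA; rewrite -[X in measurable X]setTI; exact: measurable_torus_proj. Qed.

Let haar_torus0 : haar_torus set0 = 0%E.
Proof. by rewrite /haar_torus /pushforward preimage_set0 measure0. Qed.

Let haar_torus_ge0 A : (0 <= haar_torus A)%E.
Proof. by rewrite /haar_torus /pushforward; exact: measure_ge0. Qed.

Let haar_torus_sigma_additive : semi_sigma_additive haar_torus.
Proof.
move=> F mF tF mUF; rewrite /haar_torus /pushforward preimage_bigcup.
apply: measure_semi_sigma_additive.
- by move=> n; exact: measurable_proj_preimage.
- apply/trivIsetP => /= i j _ _ ij; rewrite -preimage_setI.
  by move/trivIsetP : tF => /(_ _ _ _ _ ij) ->//; rewrite preimage_set0.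
- by rewrite -preimage_bigcup; exact: measurable_proj_preimage.
Qed.

HB.instance Definition _ := isMeasure.Build _ _ _ haar_torus
  haar_torus0 haar_torus_ge0 haar_torus_sigma_additive.

Lemma haar_torusT : haar_torus setT = 1%E.
Proof.
rewrite /haar_torus /pushforward /mrestr preimage_setT setTI.
by rewrite lebesgue_measure_itv/= lte_fin ltr01 sube0.
Qed.

Lemma lebesgue_measure_translation (a : R) (A : set (measurableTypeR R)) :
  measurable A -> mu ((fun x : R => x + a) @^-1` A) = mu A.
Proof.
have mf : measurable_fun setT
    ((fun x => x + a) : measurableTypeR R -> measurableTypeR R).
  exact: measurable_funD.
pose nu := pushforward mu ((fun x => x + a) : measurableTypeR R -> measurableTypeR R).
move=> mA; apply/esym.
apply: (lebesgue_measure_unique (mu := [the measure _ _ of nu])) => //.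
move=> _ [[b c]] _ <-; rewrite /= /nu /pushforward.
have -> : (fun x : R => x + a) @^-1` `]b, c] = `](b - a), (c - a)]%classic.
  by apply/seteqP; split=> x /=; rewrite !in_itv/= ltrBlDr lerBrDr.
rewrite !lebesgue_measure_itv/= !lte_fin ltrD2r.
by case: ifP => // _; rewrite -!EFinB opprD addrACA subrr addr0.
Qed.

Lemma haar_torus_invariant (a : torus R) (A : set torus_measurableType) :
  measurable A -> haar_torus ((fun x : torus R => x + a) @^-1` A) = haar_torus A.
Proof.
move=> mA; have /andP[a0 a1] := torus_valP a; set t := torus_val a in a0 a1 *.
rewrite /haar_torus /pushforward /mrestr.
set B : set R := @torus_proj R @^-1` A.
have mB : measurable (B : set (measurableTypeR R)) by exact: measurable_proj_preimage.
have mI (i : interval R) : measurable (B `&` [set` i] : set (measurableTypeR R)).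
  by apply: measurableI; [exact: mB|exact: measurable_itv].
transitivity (mu (B `&` `[t, 1 + t[)).
  rewrite -(lebesgue_measure_translation t (mI `[t, 1 + t[)).
  congr (mu _); apply/seteqP; split=> x /=;
    rewrite !in_itv/= lerDr ltrD2r /B /= torus_projD (torus_proj_val a) //.
have splitB x y z : x <= y -> y <= z ->
    mu (B `&` `[x, z[) = (mu (B `&` `[x, y[) + mu (B `&` `[y, z[))%E.
  move=> xy yz; rewrite -measureU; [|exact: (mI `[x, y[)|exact: (mI `[y, z[)|].
    rewrite -setIUr; congr (mu (_ `&` _)); apply/seteqP; split=> u /=;
      rewrite !in_itv/=.
      by move=> /andP[-> ->]; rewrite andbT /=; case: (ltP u y); [left|right].
    by case=> /andP[h1 h2]; [rewrite h1 (lt_le_trans h2)|rewrite h2 (le_trans xy)].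
  apply/seteqP; split=> u //= [[_]]; rewrite !in_itv/= => /andP[_ uy] [_ /andP[]].
  by rewrite leNgt uy.
have t1 : 1 <= 1 + t by rewrite lerDl.
rewrite (splitB _ _ _ (ltW a1) t1) (splitB _ _ _ a0 (ltW a1)) addeC.
congr (_ + _)%E.
rewrite -(lebesgue_measure_translation 1 (mI `[1, 1 + t[)).
congr (mu _); apply/seteqP; split=> x /=;
  by rewrite !in_itv/= lerDr addrC ltrD2l /B /= addrC (torus_projDz x 1).
Qed.

End torus_haar.

Record haar_group (R : realType) := HaarGroup {
  haar_display : measure_display;
  haar_carrier :> measurableType haar_display;
  haar_measure : {measure set haar_carrier -> \bar R} }.

Definition circle_group (R : realType) : haar_group R :=
  @HaarGroup R _ (torus_measurableType R) (@haar_torus R).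

Definition real_line_group (R : realType) : haar_group R :=
  @HaarGroup R _ (measurableTypeR R) (@lebesgue_measure R).

(* Elements of L^r(G) and of M(X) are classes of functions modulo equality
   almost everywhere.  An operator L^r(G) -> M(X) is represented by a map
   between functions, constrained on L^r(G) only, that respects these classes;
   linearity holds modulo null sets. *)
Definition linear_operator (R : realType) (G : haar_group R) (r : R)
    (dX : measure_display) (X : measurableType dX)
    (mu : {measure set X -> \bar R}) (T : (G -> R) -> (X -> R)) : Prop :=
  let Lr := Lfun (@haar_measure R G) r%:E in
  [/\ forall f : G -> R, f \in Lr -> measurable_fun setT (T f),
      forall f g : G -> R, f \in Lr -> g \in Lr ->
        f = g %[ae @haar_measure R G] -> T f = T g %[ae mu]
    & forall (a : R) (f g : G -> R), f \in Lr -> g \in Lr ->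
        T (fun x => a * f x + g x) = (fun x => a * T f x + T g x) %[ae mu] ].

Definition nontrivial_weight (R : realType) (dX : measure_display)
    (X : measurableType dX) (mu : {measure set X -> \bar R})
    (phi : X -> R) : Prop :=
  [/\ measurable_fun setT phi, forall x, 0 <= phi x
    & ~ (phi = cst 0 %[ae mu]) ].

Definition bounded_to_weighted_Lp (R : realType) (G : haar_group R) (r : R)
    (dX : measure_display) (X : measurableType dX)
    (mu : {measure set X -> \bar R}) (T : (G -> R) -> (X -> R))
    (p : R) (phi : X -> R) : Prop :=
  exists C : R, forall f : G -> R, f \in Lfun (@haar_measure R G) r%:E ->
    ((\int[mu]_x (`|T f x| `^ p * phi x)%:E) `^ p^-1 <=
       C%:E * 'N[@haar_measure R G]_(r%:E)[EFin \o f])%E.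

Definition multilinear_bound (R : realType) (d : nat)
    (G : 'I_d -> haar_group R) (r gamma : 'I_d -> R)
    (dX : measure_display) (X : measurableType dX)
    (mu : {measure set X -> \bar R})
    (T : forall j, (G j -> R) -> (X -> R)) : Prop :=
  exists C : R, forall f : (forall j, G j -> R),
    (forall j, f j \in Lfun (@haar_measure R (G j)) (r j)%:E) ->
    (\int[mu]_x (\prod_(j < d) `|T j (f j) x| `^ gamma j)%:E <=
     (C * \prod_(j < d)
        fine ('N[@haar_measure R (G j)]_((r j)%:E)[EFin \o f j]) `^ gamma j)%:E)%E.

Definition exponent_hyperplane (R : realType) (d : nat) (gamma : 'I_d -> R) :
    set ('I_d -> R) :=
  [set p | (forall j, 0 < p j) /\ \sum_(j < d) gamma j / p j = 1].

Definition bounded_exponents (R : realType) (d : nat)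
    (G : 'I_d -> haar_group R) (r gamma : 'I_d -> R)
    (dX : measure_display) (X : measurableType dX)
    (mu : {measure set X -> \bar R})
    (T : forall j, (G j -> R) -> (X -> R)) : set ('I_d -> R) :=
  exponent_hyperplane gamma `&`
  [set p | forall j, exists phi : X -> R, nontrivial_weight mu phi /\
     bounded_to_weighted_Lp (r j) mu (T j) (p j) phi].

Definition J (R : realType) (r gamma : R) : set R :=
  if (2 <= gamma < r) || (r <= gamma) then `]0, gamma]%classic
  else if gamma < 2 <= r then `]0, 2]%classic
  else `]0, r[%classic (* here gamma < r < 2 *).

(* Main.v *)
Require Import Defs.
From HB Require Import structures.
From mathcomp Require Import all_boot all_order all_algebra.
From mathcomp Require Import all_classical all_reals all_analysis.
From mathcomp Require Import measurable_realfun.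
From mathcomp Require Import ring lra.

(** The argument separates into arithmetic of the exponents and the
    construction of one operator for each pair (r, gamma).

    Arithmetic.  On the hyperplane every p_j exceeds gamma_j, because at least
    two positive terms gamma_i / p_i add up to 1.  If moreover p_j is in J_j,
    then gamma_j < min(r_j, 2), and J_j is (0, r_j) or (0, 2].  So the sum of
    the gamma_j / min(r_j, 2) is at most 1, strictly less if some r_j < 2;
    conversely the point p_j proportional to min(r_j, 2) is in the set.

    Reduction to one factor.  Let X be the product of d copies of [0, 1] and
    T_j f (x) = S_j f (x_j).  By Tonelli the multilinear bound is a product of
    bounds S_j : L^(r_j) -> L^(gamma_j), and it suffices to find, for each r
    and gamma, an operator S on L^r of the line which is bounded into L^p for
    p in J and into no L^p (phi) for p outside J ([sharp_operator]).  To defeat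
    all weights at once, S has finite families h_i in the unit ball for which
    the mean over i of |S h_i|^p is at least B at every point, with B as large
    as desired: integrated against phi, this gives B int phi <= C^p.

    Gluing.  S f is the sum of the 4^-(k+1) S_k f, where the S_k have finite
    rank, S_k f = sum_i <f, h_i> g_i.  They are bounded from L^r to L^p
    uniformly in k for p in J, while the means of the |g_i|^p outgrow every
    power of 4^k for p outside J ([glued_sharp]).  The g_i are functions on a
    finite probability space, carried to [0, 1] by a partition into equal
    cells, so both properties are inequalities about finite sums.

    The models.  Spikes M^(1/q) 1_{t = i} on M points are bounded from l^rho
    to L^q for rho <= q, and their p-th powers have mean M^(p/q - 1) over i,
    which is unbounded for p > q.
    - If gamma >= r, take q = gamma and rho = r; the h_i are indicators of
      disjoint unit intervals.
    - If r >= 2, take q = max(gamma, 2) and rho = 2; the h_i are random signs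
      on a unit interval, and Bessel's inequality bounds the coefficients.
    - If gamma < r < 2, the spikes are replaced by a random sign times v^(1/r),
      where v > lambda has probability of order 1 / lambda, as for r-stable
      variables.  These are bounded from l^r to L^p for p < r
      ([stable_level_le]), but the mean of the r-th powers is logarithmically
      large at every point ([stable_level_ge]). *)

Set Implicit Arguments.
Unset Strict Implicit.
Unset Printing Implicit Defensive.

Import Order.TTheory GRing.Theory Num.Theory.
Import numFieldNormedType.Exports.

Local Open Scope classical_set_scope.
Local Open Scope ring_scope.

(** * Exponents on the hyperplane *)

Lemma le_of_eq (disp : Order.disp_t) (T : porderType disp) (x y : T) :
  x = y -> (x <= y)%O.
Proof. by move=> ->. Qed.

Lemma lt_sum_term (R : realType) (d : nat) (a : 'I_d -> R) (j : 'I_d) :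
  (2 <= d)%N -> (forall j, 0 < a j) -> a j < \sum_(i < d) a i.
Proof.
move=> d2 a0.
have [i ij] : exists i : 'I_d, i != j.
  have : (0 < #|predC1 j|)%N by rewrite cardC1 card_ord -ltnS (ltn_predK d2).
  by case/card_gt0P => i; exists i.
rewrite (bigD1 j) //= ltrDl (bigD1 i) //=; apply: ltr_wpDr => //.
by apply: sumr_ge0 => k _; exact: ltW.
Qed.

Lemma hyperplane_gt (R : realType) (d : nat) (gamma p : 'I_d -> R) (j : 'I_d) :
  (2 <= d)%N -> (forall j, 0 < gamma j) -> exponent_hyperplane gamma p ->
  gamma j < p j.
Proof.
move=> d2 g0 [p0 s1].
have := @lt_sum_term R d (fun i => gamma i / p i) j d2.
rewrite s1 => /(_ (fun i => divr_gt0 (g0 i) (p0 i))).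
by rewrite ltr_pdivrMr // mul1r.
Qed.

Lemma J_small (R : realType) (r gamma : R) : gamma < Num.min r 2 ->
  J r gamma = [set p | if r < 2 then 0 < p < r else 0 < p <= 2].
Proof.
rewrite lt_min => /andP[gr g2]; rewrite /J leNgt g2 /= leNgt gr /=.
rewrite leNgt; case: ltP => // _; apply/seteqP; split => p /=;
  by rewrite in_itv.
Qed.

(** Of the three shapes of J, the interval (0, gamma] contains no p > gamma;
    the other two are bounded by min(r, 2). *)
Lemma J_ltmin (R : realType) (r gamma p : R) : gamma < p -> J r gamma p ->
  gamma < Num.min r 2 /\ p <= Num.min r 2.
Proof.
move=> gp; rewrite /J.
case: ifPn => [_ | ]; first by rewrite /= in_itv /= => /andP[_]; rewrite leNgt gp.
rewrite negb_or -ltNge => /andP[h1 gr].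
case: ifPn => [/andP[g2 r2] | h2]; rewrite /= in_itv /= => /andP[p0 pr].
  by rewrite lt_min gr g2 le_min pr (le_trans pr r2).
have r2 : r < 2.
  rewrite ltNge; apply/negP => r2; move: h1 h2; rewrite gr r2 !andbT.
  by rewrite -leNgt => /negP h /h.
by rewrite lt_min gr (lt_trans gr r2) le_min ltW // ltW // (lt_trans pr r2).
Qed.

(** Necessity: replacing p_j by min(r_j, 2) >= p_j increases no term of the sum,
    and decreases it strictly where J_j is open on the right.  Sufficiency:
    with s the sum of the gamma_j / min(r_j, 2), the point s min(r_j, 2) is on
    the hyperplane, and s < 1 keeps it off the excluded endpoints r_j < 2. *)
Lemma J_hyperplane_nonempty (R : realType) (d : nat) (r gamma : 'I_d -> R) :
  (2 <= d)%N -> (forall j, 1 <= r j) -> (forall j, 0 < gamma j) ->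
  let S := [set p | forall j, J (r j) (gamma j) (p j)]
              `&` exponent_hyperplane gamma in
   (S !=set0 <->
           ((exists j, r j < 2) ->
              \sum_(j < d) gamma j / Num.min (r j) 2 < 1) /\
           ((forall j, 2 <= r j) -> \sum_(j < d) gamma j <= 2)).
Proof.
move=> d2 r1 g0 S.
have m0 j : 0 < Num.min (r j) 2 by rewrite lt_min (lt_le_trans ltr01 (r1 j)) /=.
split.
- move=> [p [pJ ph]]; have [p0 s1] := ph.
  have pm j : p j <= Num.min (r j) 2 by have [] := J_ltmin (hyperplane_gt j d2 g0 ph) (pJ j).
  have le j : gamma j / Num.min (r j) 2 <= gamma j / p j.
    by rewrite ler_pM2l // lef_pV2 ?posrE.
  split.
  + move=> [j rj]; rewrite -[ltRHS]s1 [ltLHS](bigD1 j) //= [ltRHS](bigD1 j) //=.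
    apply: ltr_leD; last by apply: ler_sum => i _; exact: le.
    rewrite ltr_pM2l // ltf_pV2 ?posrE // lt_min.
    have := pJ j; rewrite J_small; last by have [] := J_ltmin (hyperplane_gt j d2 g0 ph) (pJ j).
    by rewrite /= rj => /andP[_ h]; rewrite h (lt_trans h rj).
  + move=> r2; rewrite -[leRHS]mul1r -ler_pdivrMr // mulr_suml -[leRHS]s1.
    by apply: ler_sum => j _; have := le j; rewrite min_r.
- move=> [c1 c2].
  pose s := \sum_(j < d) gamma j / Num.min (r j) 2.
  have [s1 sr] : s <= 1 /\ forall j, r j < 2 -> s < 1.
    have [rlt|rge] := pselect (exists j, r j < 2).
      by have s1 := c1 rlt; split=> [|_ _]; rewrite ?ltW.
    have {}rge j : 2 <= r j by rewrite leNgt; apply/negP => rj; apply: rge; exists j.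
    split=> [|j]; last by rewrite ltNge rge.
    rewrite /s; under eq_bigr do rewrite min_r //.
    by rewrite -mulr_suml ler_pdivrMr // mul1r; exact: c2.
  have gs j : gamma j / Num.min (r j) 2 < s.
    by apply: (@lt_sum_term R d (fun i => gamma i / Num.min (r i) 2)) => // i; rewrite divr_gt0.
  have s0 : 0 < s by apply: lt_trans (gs (Ordinal (ltnW d2))); rewrite divr_gt0.
  exists (fun j => s * Num.min (r j) 2); split; last split.
  + move=> j; rewrite J_small /=; last first.
      by rewrite -[ltRHS]mul1r -ltr_pdivrMr // (lt_le_trans (gs j)).
    case: ltP => rj; rewrite mulr_gt0 ?(lt_le_trans ltr01 (r1 j)) //=.
      by rewrite gtr_pMl ?(sr j) // (lt_le_trans ltr01 (r1 j)).
    by rewrite ger_pMl.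
  + by move=> j; rewrite mulr_gt0.
  + under eq_bigr do rewrite invfM mulrCA.
    by rewrite -mulr_sumr mulVf // gt_eqF.
Qed.

(** A single point of the set forces gamma_j < min(r_j, 2) for all j, and this
    determines the shape of every J_j. *)
Lemma J_hyperplane_eq (R : realType) (d : nat) (r gamma : 'I_d -> R) :
  (2 <= d)%N -> (forall j, 0 < gamma j) ->
  let S := [set p | forall j, J (r j) (gamma j) (p j)]
              `&` exponent_hyperplane gamma in
  S !=set0 ->
           S = [set p | forall j, if r j < 2 then 0 < p j < r j
                                  else 0 < p j <= 2]
                 `&` exponent_hyperplane gamma.
Proof.
move=> d2 g0 S [p [pJ ph]]; rewrite /S; congr (_ `&` _).
apply/seteqP; split => q /= qJ j; move: (qJ j); rewrite (J_small _) //;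
 by have [] := J_ltmin (hyperplane_gt j d2 g0 ph) (pJ j).
Qed.

(** * Product of probability spaces *)

Definition unif (R : realType) : probability (measurableTypeR R) R :=
  @uniform_prob R 0 1 ltr01.

(** The integral of a product of functions of separate coordinates, stated with
    real upper bounds so as to avoid products of extended reals.  The induction
    splits off one coordinate with Tonelli. *)
Lemma product_space (R : realType) (n : nat) :
  exists (dX : measure_display) (X : measurableType dX) (mu : probability X R)
    (pi : 'I_n -> X -> measurableTypeR R),
    (forall j, measurable_fun setT (pi j)) /\
    forall (F : 'I_n -> R -> R) (c : 'I_n -> R),
      (forall j, measurable_fun setT (F j : measurableTypeR R -> R)) ->
      (forall j x, 0 <= F j x) ->
      (forall j, \int[unif R]_x (F j x)%:E <= (c j)%:E)%E ->
      (\int[mu]_x (\prod_(j < n) F j (pi j x))%:E <= (\prod_(j < n) c j)%:E)%E.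
Proof.
elim: n => [|n [dX [X [mu [pi [mpi IH]]]]]].
  exists _, (measurableTypeR R), (unif R), (fun _ x => x); split.
    by case.
  move=> F c _ _ _; rewrite big_ord0; under eq_integral do rewrite big_ord0.
  by rewrite integral_cst //= probability_setT mul1e.
pose pi' (j : 'I_n.+1) (z : measurableTypeR R * X) : measurableTypeR R :=
  if unlift ord0 j is Some i then pi i z.2 else z.1.
exists _, _, [the probability _ _ of (unif R \x mu)%E], pi'; split.
  move=> j; rewrite /pi'; case: unliftP => [i _|_]; last exact: measurable_fst.
  by apply: measurableT_comp => //; exact: measurable_snd.
move=> F c mF F0 Fc.
pose Q y := \prod_(j < n) F (lift ord0 j) (pi j y).
have Q0 y : 0 <= Q y by apply: prodr_ge0.
have mQ : measurable_fun setT Q.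
  apply: measurable_prod => j _.
  exact: (measurableT_comp (mF (lift ord0 j)) (mpi j)).
have E z : \prod_(j < n.+1) F j (pi' j z) = F ord0 z.1 * Q z.2.
  rewrite big_ord_recl /pi' unlift_none; congr (_ * _).
  by apply: eq_bigr => i _; rewrite liftK.
under eq_integral do rewrite E.
rewrite fubini_tonelli1 /fubini_F; last 2 first.
  apply/measurable_EFinP; apply: measurable_funM.
    by apply: measurableT_comp (mF _) _; exact: measurable_fst.
  by apply: measurableT_comp mQ _; exact: measurable_snd.
  by move=> z; rewrite lee_fin mulr_ge0.
rewrite big_ord_recl.
have HQ := IH (fun j => F (lift ord0 j)) (fun j => c (lift ord0 j))
  (fun j => mF (lift ord0 j)) (fun j => F0 (lift ord0 j)) (fun j => Fc (lift ord0 j)).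
set C := \prod_(j < n) _ in HQ *.
have C0 : 0 <= C.
  rewrite -lee_fin; apply: le_trans HQ; apply: integral_ge0 => y _.
  by rewrite lee_fin prodr_ge0.
apply: (@le_trans _ _ (\int[unif R]_x (F ord0 x * C)%:E)%E).
  apply: ge0_le_integral => //=.
  - by move=> x _; apply: integral_ge0 => y _; rewrite lee_fin mulr_ge0.
  - apply: (@measurable_fun_fubini_tonelli_F _ _ _ _ _ mu
             (fun z => (F ord0 z.1 * Q z.2)%:E)) => //=.
    + apply/measurable_EFinP; apply: measurable_funM.
        by apply: measurableT_comp (mF _) _; exact: measurable_fst.
      by apply: measurableT_comp mQ _; exact: measurable_snd.
    + by move=> z; rewrite lee_fin mulr_ge0.
  - by apply/measurable_EFinP; apply: measurable_funM.
  - move=> x _; under eq_integral do rewrite EFinM.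
    rewrite ge0_integralZl_EFin //; last 2 first.
      by move=> y _; rewrite lee_fin.
      exact/measurable_EFinP.
    by rewrite EFinM lee_wpmul2l // lee_fin.
under eq_integral do rewrite EFinM.
rewrite ge0_integralZr //; last 2 first.
- exact/measurable_EFinP.
- by move=> x _; rewrite lee_fin.
by rewrite EFinM lee_wpmul2r // lee_fin.
Qed.

(** * From one coordinate to the product *)

Section lnorm_facts.
Context d (T : measurableType d) (R : realType) (mu : {measure set T -> \bar R}).
Variable r : R.
Hypothesis r1 : 1 <= r.

Lemma Lfun_measurable (f : T -> R) : f \in Lfun mu r%:E -> measurable_fun setT f.
Proof. by rewrite inE => /andP[/[!inE]/=]. Qed.

Lemma Lfun_fineK (f : T -> R) : f \in Lfun mu r%:E ->
  (fine ('N[mu]_(r%:E)[EFin \o f]))%:E = 'N[mu]_(r%:E)[EFin \o f]%E.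
Proof.
rewrite inE => /andP[_ /[!inE]/= h].
by rewrite fineK // ge0_fin_numE // Lnorm_ge0.
Qed.

Lemma Lfun_integral_powR (f : T -> R) : f \in Lfun mu r%:E ->
  (\int[mu]_x (`|f x| `^ r)%:E)%E =
  (fine ('N[mu]_(r%:E)[EFin \o f]) `^ r)%:E.
Proof.
move=> fL; rewrite -poweR_EFin Lfun_fineK // powR_Lnorm ?gt_eqF ?(lt_le_trans ltr01) //.
Qed.

End lnorm_facts.

(** The last clause is a form of unboundedness that does not mention weights,
    and therefore passes from [0, 1] to a product containing it: integrating
    the pointwise bound against any phi yields B int phi <= C^p. *)
Definition sharp_operator (R : realType) (r gamma : R)
    (S : (R -> R) -> (R -> R)) : Prop :=
  [/\ @linear_operator R (real_line_group R) r _ (measurableTypeR R) (unif R) S,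
      forall p, 0 < p -> J r gamma p ->
        exists C : R, forall f : R -> R, f \in Lfun (@lebesgue_measure R) r%:E ->
        (\int[unif R]_x (`|S f x| `^ p)%:E <=
         (C * fine ('N[@lebesgue_measure R]_(r%:E)[EFin \o f]) `^ p)%:E)%E
    & forall p, 0 < p -> ~ J r gamma p -> forall B : R,
        exists (I : finType) (h : I -> R -> R),
        [/\ (0 < #|I|)%N,
            forall i, h i \in Lfun (@lebesgue_measure R) r%:E,
            forall i, ('N[@lebesgue_measure R]_(r%:E)[EFin \o h i] <= 1)%E
          & forall x, #|I|%:R * B <= \sum_i `|S (h i) x| `^ p] ].

Lemma J_gamma (R : realType) (r gamma : R) : 0 < gamma -> J r gamma gamma.
Proof.
move=> g0; rewrite /J; case: ifPn => [_|]; first by rewrite /= in_itv /= g0 lexx.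
rewrite negb_or -ltNge => /andP[h1 gr].
case: ifPn => [/andP[g2 r2] | h2]; rewrite /= in_itv /= g0 //.
by rewrite ltW.
Qed.

Section assembly.
Context (R : realType) (d : nat) (r gamma : 'I_d -> R).
Context (S : 'I_d -> (R -> R) -> (R -> R)).
Hypothesis r1 : forall j, 1 <= r j.
Hypothesis g0 : forall j, 0 < gamma j.
Hypothesis HS : forall j, sharp_operator (r j) (gamma j) (S j).
Context (dX : measure_display) (X : measurableType dX) (mu : probability X R)
    (pi : 'I_d -> X -> measurableTypeR R).
Hypothesis mpi : forall j, measurable_fun setT (pi j).
Hypothesis Hpi : forall (F : 'I_d -> R -> R) (c : 'I_d -> R),
      (forall j, measurable_fun setT (F j : measurableTypeR R -> R)) ->
      (forall j x, 0 <= F j x) ->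
      (forall j, \int[unif R]_x (F j x)%:E <= (c j)%:E)%E ->
      (\int[mu]_x (\prod_(j < d) F j (pi j x))%:E <= (\prod_(j < d) c j)%:E)%E.

Let T (j : 'I_d) (f : real_line_group R -> R) (x : X) : R := S j f (pi j x).

(** The factors other than the j-th are taken equal to 1. *)
Lemma marginal_le (j : 'I_d) (F : R -> R) (c : R) :
  measurable_fun setT (F : measurableTypeR R -> R) -> (forall x, 0 <= F x) ->
  (\int[unif R]_x (F x)%:E <= c%:E)%E ->
  (\int[mu]_x (F (pi j x))%:E <= c%:E)%E.
Proof.
move=> mF F0 Fc.
have := Hpi (F := fun i => if i == j then F else cst 1)
            (c := fun i => if i == j then c else 1).
have -> : \prod_(i < d) (if i == j then c else 1) = c.
  by rewrite (bigD1 j) //= eqxx big1 ?mulr1 // => i /negbTE ->.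
move=> H; apply: le_trans (H _ _ _); last 3 first.
- by move=> i; case: ifP => _ //; exact: measurable_cst.
- by move=> i x; case: ifP => _ //=.
- by move=> i; case: ifP => _ //; rewrite (integral_cst _ _ 1) //= probability_setT mul1e.
apply: le_of_eq; apply: eq_integral => x _.
by rewrite (bigD1 j) //= eqxx big1 ?mulr1 // => i /negbTE ->.
Qed.

Lemma marginal_ae (j : 'I_d) (f g : measurableTypeR R -> R) :
  measurable_fun setT (f : measurableTypeR R -> R) ->
  measurable_fun setT (g : measurableTypeR R -> R) ->
  f = g %[ae unif R] -> (fun x => f (pi j x)) = (fun x => g (pi j x)) %[ae mu].
Proof.
move=> mf mg fg.
have mfg : measurable_fun setT (fun x => `|f x - g x| : measurableTypeR R).
  by apply: measurableT_comp => //; exact: measurable_funB.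
have H : (\int[mu]_x (`|f (pi j x) - g (pi j x)|)%:E <= 0%:E)%E.
  apply: (@marginal_le j (fun x => `|f x - g x|)) => //.
  rewrite (ge0_ae_eq_integral (g := cst 0%E)) ?integral0 //.
  - exact/measurable_EFinP.
  - by apply: filterS fg => x /(_ Logic.I) /= -> _; rewrite subrr normr0.
have : (\int[mu]_x `|(`|f (pi j x) - g (pi j x)|)%:E| = 0)%E.
  apply/eqP; rewrite eq_le; apply/andP; split; last exact: integral_ge0.
  by under eq_integral do rewrite /= normr_id.
have mE : measurable_fun setT (fun x => (`|f (pi j x) - g (pi j x)|)%:E).
  by apply/measurable_EFinP; apply: measurableT_comp mfg (mpi j).
move/(ae_eq_integral_abs _ measurableT mE).
apply: filterS => x /(_ Logic.I) [] /eqP.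
by rewrite normr_eq0 subr_eq0 => /eqP.
Qed.

Lemma product_operator_linear j : @linear_operator R (real_line_group R) (r j) _ X mu (T j).
Proof.
have [[L1 L2 L3] _ _] := HS j; split.
- move=> f fL; apply: measurableT_comp (mpi j); exact: L1.
- by move=> f g fL gL fg; apply: marginal_ae; [exact: L1|exact: L1|exact: L2].
- move=> a f g fL gL; apply: (@marginal_ae j (S j _) (fun x => a * S j f x + S j g x)).
  + apply: L1; have r1' : (1 <= (r j)%:E)%E by rewrite lee_fin.
    by have [_] := @Lfun_submod_closed _ _ _ (@lebesgue_measure R) _ r1'; exact.
  + by apply: measurable_funD; [apply: measurable_funM => //; exact: L1|exact: L1].
  + exact: L3.
Qed.

Lemma product_operator_multilinear :
  @multilinear_bound R d (fun=> real_line_group R) r gamma _ X mu T.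
Proof.
have /boolp.choice[C HC] : forall j, exists C : R, forall f : R -> R,
        f \in Lfun (@lebesgue_measure R) (r j)%:E ->
        (\int[unif R]_x (`|S j f x| `^ gamma j)%:E <=
         (C * fine ('N[@lebesgue_measure R]_((r j)%:E)[EFin \o f]) `^ gamma j)%:E)%E.
  by move=> j; have [_ H _] := HS j; apply: H => //; exact: J_gamma.
exists (\prod_(j < d) C j) => f fL.
rewrite -big_split /=.
apply: (Hpi (F := fun j x => `|S j (f j) x| `^ gamma j)) => [j|j x|j].
- have [[L1 _ _] _ _] := HS j.
  apply: (measurableT_comp (measurable_powR _)) => //.
  by apply: measurableT_comp => //; exact: L1.
- exact: powR_ge0.
- exact: HC.
Qed.

Lemma product_operator_bounded j p : 0 < p -> J (r j) (gamma j) p ->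
  exists phi : X -> R, nontrivial_weight mu phi /\
     @bounded_to_weighted_Lp R (real_line_group R) (r j) _ X mu (T j) p phi.
Proof.
move=> p0 Jp; exists (cst 1); split.
  split=> // H; have : (\int[mu]_x (cst 1%:E x) = 0)%E.
    rewrite (ge0_ae_eq_integral (g := cst 0%E)) ?integral0 //.
    by apply: filterS H => x /(_ Logic.I) /= -> _.
  by rewrite integral_cst //= probability_setT mul1e => /eqP; rewrite onee_eq0.
have [[L1 _ _] H _] := HS j.
have [C HC] := H p p0 Jp.
exists (`|C| `^ p^-1) => f fL.
have p1 : p^-1 != 0 by rewrite invr_neq0 // gt_eqF.
rewrite -(Lfun_fineK fL) -EFinM.
have N0 : 0 <= fine ('N[@lebesgue_measure R]_(r j)%:E[EFin \o f]).
  by rewrite fine_ge0 // Lnorm_ge0.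
set N := fine _ in N0 *.
have -> : `|C| `^ p^-1 * N = (`|C| * N `^ p) `^ p^-1.
  by rewrite powRM ?powR_ge0 // -powRrM mulfV ?gt_eqF // powRr1.
rewrite -poweR_EFin.
apply: gt0_ler_poweR; rewrite ?in_itv /= ?leey ?andbT ?invr_ge0 ?(ltW p0) //.
- by apply: integral_ge0 => x _; rewrite lee_fin mulr_ge0 // powR_ge0.
- by rewrite lee_fin mulr_ge0 // powR_ge0.
under eq_integral do rewrite /cst mulr1.
apply: (@le_trans _ _ (C * N `^ p)%:E).
  apply: (@marginal_le j (fun x => `|S j f x| `^ p)); last exact: HC.
  - apply: (measurableT_comp (measurable_powR _)) => //.
    by apply: measurableT_comp => //; exact: L1.
  - by move=> x; exact: powR_ge0.
by rewrite lee_fin ler_wpM2r ?powR_ge0 // ler_norm.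
Qed.

(** With 0 < e <= int phi and K the constant of the weighted bound on the unit
    ball, summing over the family h gives #|I| B e <= #|I| K, which fails for
    B = (K + 1) / e. *)
Lemma product_operator_unbounded j p : 0 < p -> ~ J (r j) (gamma j) p ->
  ~ exists phi : X -> R, nontrivial_weight mu phi /\
     @bounded_to_weighted_Lp R (real_line_group R) (r j) _ X mu (T j) p phi.
Proof.
move=> p0 Jp [phi [[mphi phi0 nphi] [C HC]]].
have [[L1 _ _] _ H] := HS j.
have mSp f : f \in Lfun (@lebesgue_measure R) (r j)%:E ->
    measurable_fun setT (fun x => `|T j f x| `^ p).
  move=> fL; apply: (measurableT_comp (measurable_powR _)) => //.
  apply: measurableT_comp => //.
  by apply: measurableT_comp (mpi j); exact: L1.
(* The integral of phi may be infinite, hence the real minorant e. *)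
have [e e0 he] : exists2 e : R, 0 < e & (e%:E <= \int[mu]_x (phi x)%:E)%E.
  have I0 : (0 <= \int[mu]_x (phi x)%:E)%E by apply: integral_ge0 => x _; rewrite lee_fin.
  have : (0 < \int[mu]_x (phi x)%:E)%E.
    rewrite lt0e I0 andbT; apply/negP => /eqP H0; apply: nphi.
    have : (\int[mu]_x `|(phi x)%:E| = 0)%E.
      by rewrite -[RHS]H0; apply: eq_integral => x _; rewrite gee0_abs // lee_fin.
    have mE : measurable_fun setT (fun x => (phi x)%:E) by exact/measurable_EFinP.
    move/(ae_eq_integral_abs _ measurableT mE).
    by apply: filterS => x /(_ Logic.I) [].
  case: (\int[mu]_x (phi x)%:E)%E => [e| |] //.
    by rewrite lte_fin => e0; exists e.
  by move=> _; exists 1; rewrite // leey.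
pose K := Num.max C 0 `^ p.
have K0 : 0 <= K by apply: powR_ge0.
have [I [h [I0 hL h1 hB]]] := H p p0 Jp ((K + 1) / e).
have Ki i : (\int[mu]_x (`|T j (h i) x| `^ p * phi x)%:E <= K%:E)%E.
  have J0 : (0 <= \int[mu]_x (`|T j (h i) x| `^ p * phi x)%:E)%E.
    by apply: integral_ge0 => x _; rewrite lee_fin mulr_ge0 // powR_ge0.
  rewrite -[leLHS]poweRe1 // -[1%R](@mulVf _ p) ?gt_eqF // poweRrM /K -poweR_EFin.
  apply: gt0_ler_poweR; rewrite ?in_itv /= ?leey ?andbT ?poweR_ge0 ?(ltW p0) //.
    by rewrite lee_fin le_max lexx orbT.
  apply: le_trans (HC _ (hL i)) _.
  apply: (@le_trans _ _ ((Num.max C 0)%:E * 'N[@lebesgue_measure R]_(r j)%:E[EFin \o h i])%E).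
    by apply: lee_wpmul2r; rewrite ?Lnorm_ge0 // lee_fin le_max lexx.
  by rewrite -[leRHS]mule1; apply: lee_wpmul2l; rewrite ?h1 // lee_fin le_max lexx orbT.
have mTp i : measurable_fun setT (fun x => (`|T j (h i) x| `^ p * phi x)%:E).
  by apply/measurable_EFinP; apply: measurable_funM => //; exact: mSp.
have : (\int[mu]_x (#|I|%:R * ((K + 1) / e) * phi x)%:E <= (#|I|%:R * K)%:E)%E.
  apply: (@le_trans _ _ (\int[mu]_x (\sum_i (`|T j (h i) x| `^ p * phi x)%:E))%E).
    apply: ge0_le_integral => //=.
    - move=> x _; rewrite lee_fin mulr_ge0 // mulr_ge0 // divr_ge0 ?ltW //.
      by rewrite ltr_wpDl.
    - by apply/measurable_EFinP; apply: measurable_funM.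
    - by apply: emeasurable_sum => i; exact: mTp.
    - move=> x _; rewrite sumEFin lee_fin -mulr_suml.
      by apply: ler_wpM2r => //; exact: hB.
  rewrite ge0_integral_sum //; last first.
    by move=> i x _; rewrite lee_fin mulr_ge0 // powR_ge0.
  rewrite mulr_natl -sumr_const -sumEFin.
  by apply: lee_sum => i _; exact: Ki.
under eq_integral do rewrite EFinM.
rewrite ge0_integralZl_EFin //; last 3 first.
- by move=> x _; rewrite lee_fin.
- exact/measurable_EFinP.
- by rewrite mulr_ge0 // divr_ge0 ?ltW // ltr_wpDl.
apply/negP; rewrite -ltNge.
apply: lt_le_trans (_ : ((#|I|%:R * ((K + 1) / e))%:E * e%:E <= _)%E); last first.
  by apply: lee_wpmul2l => //; rewrite lee_fin mulr_ge0 // divr_ge0 ?ltW // ltr_wpDl.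
rewrite -EFinM lte_fin -!mulrA mulVf ?gt_eqF // mulr1 ltr_pM2l ?ltr0n //.
by rewrite ltrDl.
Qed.

End assembly.

(** * Series of operators with geometric weights *)

Section limsup_sum.
Context (R : realType).

(** The limit superior is defined and measurable without any convergence, and
    is the sum of the series when this converges. *)
Definition limsup_sum (u : nat -> R) : R :=
  fine (limn_esup (fun n => (\sum_(k < n) u k)%:E)).

Lemma limsup_sum_cvg (u : nat -> R) (l : R) :
  (fun n => \sum_(k < n) u k) @ \oo --> l -> limsup_sum u = l.
Proof.
move=> ul; rewrite /limsup_sum.
have : (fun n => (\sum_(k < n) u k)%:E) @ \oo --> l%:E by apply/cvg_EFin; [exact: nearW|].
by move=> /cvg_limn_einf_sup [_ ->].
Qed.

Lemma sum_half (n : nat) : \sum_(k < n) (2^-1 : R) ^+ k.+1 <= 1.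
Proof.
suff -> : \sum_(k < n) (2^-1 : R) ^+ k.+1 = 1 - 2^-1 ^+ n.
  by rewrite lerBlDr lerDl exprn_ge0.
elim: n => [|n IH]; first by rewrite big_ord0 expr0 subrr.
by rewrite big_ord_recr /= IH exprS; lra.
Qed.

(** Every 2^-(k+1) |s_k| is at most b = a^(1/p), so the k-th term of the series
    is at most 2^-(k+1) b.  This plays the role of the triangle inequality in
    L^p, uniformly for all p > 0, including p < 1. *)
Lemma limsup_sum_bound (p : R) (s : nat -> R) (a : R) : 0 < p ->
  (forall n, \sum_(k < n) (2^-1 ^+ k.+1 * `|s k|) `^ p <= a) ->
  cvgn (fun n => \sum_(k < n) 4^-1 ^+ k.+1 * s k) /\
  `|limsup_sum (fun k => 4^-1 ^+ k.+1 * s k)| `^ p <= a.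
Proof.
move=> p0 sa.
pose b := a `^ p^-1.
have b0 : 0 <= b by apply: powR_ge0.
have a0 : 0 <= a by have := sa 0%N; rewrite big_ord0.
have h0 k : 0 <= 2^-1 ^+ k.+1 * `|s k| :> R by rewrite mulr_ge0 // exprn_ge0.
have sb k : 2^-1 ^+ k.+1 * `|s k| <= b.
  have : (2^-1 ^+ k.+1 * `|s k|) `^ p <= a.
    apply: le_trans (sa k.+1); rewrite big_ord_recr /= lerDr.
    by apply: sumr_ge0 => i _; exact: powR_ge0.
  move=> /(ge0_ler_powR (r := p^-1)); rewrite !nnegrE invr_ge0 ltW // => /(_ isT).
  rewrite powR_ge0 a0 => /(_ isT isT).
  by rewrite -powRrM mulfV ?gt_eqF // powRr1.
have wb k : `|4^-1 ^+ k.+1 * s k| <= 2^-1 ^+ k.+1 * b.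
  rewrite normrM ger0_norm ?exprn_ge0 //.
  have -> : (4^-1 : R) = 2^-1 * 2^-1 by lra.
  by rewrite exprMn -mulrA ler_pM2l // exprn_gt0.
have sumb n : \sum_(k < n) `|4^-1 ^+ k.+1 * s k| <= b.
  apply: (@le_trans _ _ (\sum_(k < n) 2^-1 ^+ k.+1 * b)); first exact: ler_sum.
  by rewrite -mulr_suml -[leRHS]mul1r ler_wpM2r // sum_half.
have E : (fun n => \sum_(k < n) 4^-1 ^+ k.+1 * s k) =
         series (fun k => 4^-1 ^+ k.+1 * s k) :> (nat -> R).
  by apply/funext => n; rewrite /series /= big_mkord.
have cv : cvgn (fun n => \sum_(k < n) 4^-1 ^+ k.+1 * s k).
  rewrite E; apply: normed_cvg.
  apply: nondecreasing_is_cvgn.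
    by apply: nondecreasing_series => k /=.
  by exists b => _ [n _ <-]; rewrite /series /= /normed_series_of /series /= big_mkord.
split=> //.
rewrite (limsup_sum_cvg (l := limn (fun n => \sum_(k < n) 4^-1 ^+ k.+1 * s k))) //.
have lb : `|limn (fun n => \sum_(k < n) 4^-1 ^+ k.+1 * s k)| <= b.
  rewrite -lim_norm //; apply: limr_le; first exact: is_cvg_norm.
  by apply: nearW => n; apply: le_trans (sumb n); exact: ler_norm_sum.
apply: (@le_trans _ _ (b `^ p)); first by rewrite ge0_ler_powR ?nnegrE // ltW.
by rewrite -powRrM mulVf ?gt_eqF // powRr1.
Qed.

End limsup_sum.

Section gluing.
Context (R : realType) (r gamma : R).
Hypothesis r1 : 1 <= r.
Local Notation mu := (@lebesgue_measure R).
Local Notation Lr := (Lfun mu r%:E).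
Local Notation N f := (fine ('N[mu]_(r%:E)[EFin \o f])).

Definition pairing (h f : R -> R) : R := (\int[mu]_x (f x * h x))%R.

Context (I : nat -> finType) (h g : forall k, I k -> R -> R).
Hypothesis mg : forall k i, measurable_fun setT (g (k := k) i : measurableTypeR R -> R).
Hypothesis hI : forall k i f, f \in Lr ->
  mu.-integrable setT (EFin \o (fun x => f x * h (k := k) i x)).
Hypothesis hL : forall k i, h (k := k) i \in Lr.
Hypothesis hN : forall k i, ('N[mu]_(r%:E)[EFin \o h (k := k) i] <= 1)%E.
Hypothesis h_orth : forall k k' i i', k != k' -> pairing (h (k := k) i) (h (k := k') i') = 0.
Hypothesis h_orthn : forall k i i', pairing (h (k := k) i) (h i') = (i == i')%:R.

Definition level k (f : R -> R) (x : R) : R := \sum_(i : I k) pairing (h i) f * g i x.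

Hypothesis level_le : forall p : R, 0 < p -> J r gamma p ->
  exists C : R, forall k (f : R -> R), f \in Lr ->
    (\int[unif R]_x (`|level k f x| `^ p)%:E <= (C * N f `^ p)%:E)%E.
Hypothesis level_ge : forall p : R, 0 < p -> ~ J r gamma p -> forall B : R,
  exists k, (0 < #|I k|)%N /\
    forall x, #|I k|%:R * B <= \sum_(i : I k) (4^-1 ^+ k.+1 * `|g i x|) `^ p.
Hypothesis J_half : J r gamma 2^-1.

Definition glued (f : R -> R) (x : R) : R :=
  limsup_sum (fun k => 4^-1 ^+ k.+1 * level k f x).

Lemma measurable_level k f : measurable_fun setT (level k f : measurableTypeR R -> R).
Proof. by apply: measurable_sum => i; apply: measurable_funM. Qed.

Lemma measurable_glued f : measurable_fun setT (glued f : measurableTypeR R -> R).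
Proof.
apply: measurableT_comp; first exact: fine_measurable.
apply: measurable_fun_limn_esup => n; apply/measurable_EFinP.
by apply: measurable_sum => i; apply: measurable_funM => //; exact: measurable_level.
Qed.

Definition majorant (p : R) f (x : R) : \bar R :=
  (\sum_(k <oo) ((2^-1 ^+ k.+1 * `|level k f x|) `^ p)%:E)%E.

Lemma measurable_majorant p f :
  measurable_fun setT (majorant p f : measurableTypeR R -> \bar R).
Proof.
apply: ge0_emeasurable_sum => [k x _ _|k _]; first by rewrite lee_fin powR_ge0.
apply/measurable_EFinP; apply: (measurableT_comp (measurable_powR _)) => //.
apply: measurable_funM => //; apply: measurableT_comp => //.
exact: measurable_level.
Qed.

Lemma majorant_fin (p : R) f x : 0 < p -> (majorant p f x < +oo)%E ->
  cvgn (fun n => \sum_(k < n) 4^-1 ^+ k.+1 * level k f x) /\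
  ((`|glued f x| `^ p)%:E <= majorant p f x)%E.
Proof.
move=> p0 foo.
have A0 : (0 <= majorant p f x)%E.
  by apply: nneseries_ge0 => k _ _; rewrite lee_fin powR_ge0.
have fA : majorant p f x \is a fin_num by rewrite ge0_fin_numE.
rewrite -(fineK fA) lee_fin.
apply: limsup_sum_bound => // n; rewrite -lee_fin fineK // -sumEFin.
rewrite /majorant -(big_mkord xpredT (fun k => ((2^-1 ^+ k.+1 * `|level k f x|) `^ p)%:E)).
by apply: nneseries_lim_ge => k _; rewrite lee_fin powR_ge0.
Qed.

Lemma majorant_int (p : R) : 0 < p -> J r gamma p ->
  exists C : R, forall f, f \in Lr ->
    (\int[unif R]_x majorant p f x <= (C * N f `^ p)%:E)%E.
Proof.
move=> p0 Jp; have [C HC] := level_le p0 Jp.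
pose q : R := 2^-1 `^ p.
have q0 : 0 < q by apply: powR_gt0.
have q1 : q < 1.
  have e1 : (1 : R) `^ p = 1 by rewrite powR1.
  by rewrite -[ltRHS]e1; apply: gt0_ltr_powR; rewrite ?nnegrE // invf_lt1 ?ltr1n.
exists (`|C| / (1 - q)) => f fL.
set Np := N f `^ p; have Np0 : 0 <= Np by apply: powR_ge0.
rewrite integral_nneseries //; last first.
  move=> k; apply/measurable_EFinP; apply: (measurableT_comp (measurable_powR _)) => //.
  apply: measurable_funM => //; apply: measurableT_comp => //.
  exact: measurable_level.
have int0 k : (0 <= \int[unif R]_x ((2^-1 ^+ k.+1 * `|level k f x|) `^ p)%:E)%E.
  by apply: integral_ge0 => x _; rewrite lee_fin powR_ge0.
apply: lime_le; first by apply: is_cvg_nneseries => k _ _; exact: int0.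
apply: nearW => n; rewrite big_mkord.
apply: (@le_trans _ _ (\sum_(k < n) (q ^+ k.+1 * (`|C| * Np))%:E)%E).
  apply: lee_sum => k _.
  have E x : (2^-1 ^+ k.+1 * `|level k f x|) `^ p = q ^+ k.+1 * `|level k f x| `^ p.
    rewrite powRM // ?exprn_ge0 //; congr (_ * _).
    transitivity ((2^-1 `^ k.+1%:R) `^ p : R); first by rewrite powR_mulrn.
    by rewrite powRAC powR_mulrn ?powR_ge0.
  under eq_integral do rewrite E EFinM.
  rewrite ge0_integralZl_EFin //; last 2 first.
  - apply/measurable_EFinP; apply: (measurableT_comp (measurable_powR _)) => //.
    by apply: measurableT_comp => //; exact: measurable_level.
  - by rewrite exprn_ge0 // ltW.
  rewrite EFinM; apply: lee_wpmul2l; first by rewrite lee_fin exprn_ge0 // ltW.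
  apply: le_trans (HC k f fL) _; rewrite lee_fin ler_wpM2r // ler_norm //.
rewrite sumEFin lee_fin -mulr_suml mulrAC -[leRHS]mulrC.
apply: ler_wpM2r; first by rewrite mulr_ge0.
rewrite -[leRHS]mul1r ler_pdivlMr ?subr_gt0 //.
have -> : (\sum_(k < n) q ^+ k.+1) * (1 - q) = q - q ^+ n.+1.
  elim: n => [|n IH]; first by rewrite big_ord0 expr1 mul0r subrr.
  by rewrite big_ord_recr /= mulrDl IH !exprS; ring.
by rewrite lerBlDr ler_wpDr ?ltW // exprn_gt0.
Qed.

Lemma majorant_ae f : f \in Lr ->
  {ae unif R, forall x : measurableTypeR R, (majorant 2^-1 f x < +oo)%E}.
Proof.
move=> fL; have p0 : (0 : R) < 2^-1 by [].
have [C HC] := majorant_int p0 J_half.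
have : (unif R).-integrable setT (majorant 2^-1 f : measurableTypeR R -> \bar R).
  apply/integrableP; split; first exact: measurable_majorant.
  under eq_integral.
    move=> x _; rewrite gee0_abs; last first.
      by apply: nneseries_ge0 => k _ _; rewrite lee_fin powR_ge0.
    over.
  by apply: le_lt_trans (HC f fL) _; rewrite ltry.
move/integrable_ae => /(_ measurableT); apply: filterS => x /(_ Logic.I).
by rewrite fin_numE => /andP[_]; rewrite ltey.
Qed.

Lemma pairing_linear k (i : I k) a f1 f2 : f1 \in Lr -> f2 \in Lr ->
  pairing (h i) (fun x => a * f1 x + f2 x) = a * pairing (h i) f1 + pairing (h i) f2.
Proof.
move=> L1 L2; rewrite /pairing.
have I1 := hI i L1; have I2 := hI i L2.
rewrite -RintegralZl // -RintegralD //; last first.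
  by have := integrableZl measurableT a I1; apply: eq_integrable => // x _ /=; rewrite -EFinM.
by apply: eq_Rintegral => x _; rewrite mulrDl mulrA.
Qed.

Lemma pairing_ae k (i : I k) f1 f2 : f1 \in Lr -> f2 \in Lr ->
  ((f1 : measurableTypeR R -> R) = f2 %[ae mu]) -> pairing (h i) f1 = pairing (h i) f2.
Proof.
move=> L1 L2 f12; rewrite /pairing /Rintegral; congr fine.
apply: ae_eq_integral => //.
- by have /measurable_int := hI i L1.
- by have /measurable_int := hI i L2.
- by apply: filterS f12 => x /(_ Logic.I) /= -> _.
Qed.


Lemma glued_h k (i : I k) x : glued (h i) x = 4^-1 ^+ k.+1 * g i x.
Proof.
have E n : (k < n)%N -> \sum_(k' < n) 4^-1 ^+ k'.+1 * level k' (h i) x = 4^-1 ^+ k.+1 * g i x.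
  move=> kn; rewrite (bigD1 (Ordinal kn)) //= [X in _ + X]big1 ?addr0; last first.
    move=> k' /negbTE k'k; rewrite /level big1 ?mulr0 // => i' _.
    by rewrite h_orth ?mul0r //; apply/negP => /eqP kk'; move: k'k; rewrite -val_eqE /= kk' eqxx.
  congr (_ * _); rewrite /level (bigD1 i) //= h_orthn eqxx mul1r big1 ?addr0 //.
  by move=> i' /negbTE i'i; rewrite h_orthn i'i mul0r.
apply: limsup_sum_cvg; apply: cvg_near_cst.
by exists k.+1 => // n /= kn; rewrite E.
Qed.

(** Integrating the majorant bounds the operator.  For the exponent 1/2, which
    is in J, the majorant is almost everywhere finite, so that the series
    converge and their sums are linear.  By biorthogonality the operator maps
    h i to the single term 4^-(k+1) g i, so lower bounds on the levels are
    lower bounds on the operator. *)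
Lemma glued_sharp : sharp_operator r gamma glued.
Proof.
split.
- split.
  + by move=> f _; exact: measurable_glued.
  + move=> f1 f2 L1 L2 f12; apply: aeW => x _.
    rewrite /glued; congr limsup_sum; apply/funext => k; congr (_ * _).
    by apply: eq_bigr => i _; rewrite (pairing_ae i L1 L2 f12).
  + move=> a f1 f2 L1 L2.
    have p0 : (0 : R) < 2^-1 by [].
    have ae1 := majorant_ae L1; have ae2 := majorant_ae L2.
    apply: filterS2 ae1 ae2 => x m1 m2 _.
    have [c1 _] := majorant_fin p0 m1.
    have [c2 _] := majorant_fin p0 m2.
    rewrite /glued (limsup_sum_cvg c1) (limsup_sum_cvg c2).
    apply: limsup_sum_cvg.
    have -> : (fun n => \sum_(k < n) 4^-1 ^+ k.+1 * level k (fun x0 => a * f1 x0 + f2 x0) x) =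
       (fun n => a * (\sum_(k < n) 4^-1 ^+ k.+1 * level k f1 x) +
                 \sum_(k < n) 4^-1 ^+ k.+1 * level k f2 x).
      apply/funext => n; rewrite mulr_sumr -big_split /=; apply: eq_bigr => k _.
      rewrite mulrCA -mulrDr; congr (_ * _).
      rewrite /level mulr_sumr -big_split /=; apply: eq_bigr => i _.
      by rewrite pairing_linear // mulrDl mulrA.
    by apply: cvgD => //; apply: cvgMr.
- move=> p p0 Jp; have [C HC] := majorant_int p0 Jp; exists C => f fL.
  apply: le_trans (HC f fL); apply: ge0_le_integral => //.
  + apply/measurable_EFinP; apply: (measurableT_comp (measurable_powR _)) => //.
    by apply: measurableT_comp => //; exact: measurable_glued.
  + exact: measurable_majorant.
  + move=> x _; have [->|] := eqVneq (majorant p f x) +oo%E; first by rewrite leey.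
    by rewrite -ltey => /(majorant_fin p0)[].
- move=> p p0 Jp B; have [k [Ik HB]] := level_ge p0 Jp B.
  exists (I k), (@h k); split => // x; apply: le_trans (HB x) _.
  apply: ler_sum => i _; rewrite glued_h normrM (ger0_norm (exprn_ge0 _ _)) //.
Qed.

End gluing.

(** * Finite probability spaces inside unit intervals *)

Section cells.
Context (R : realType).
Local Notation mu := (@lebesgue_measure R).
Implicit Types (T : finType) (k n : nat).

Definition unit_itv k : set (measurableTypeR R) := `[k%:R, k.+1%:R[%classic.

Lemma measurable_unit_itv k : measurable (unit_itv k).
Proof. exact: measurable_itv. Qed.
#[local] Hint Resolve measurable_unit_itv : core.

Lemma lebesgue_unit_itv k : mu (unit_itv k) = 1%E.
Proof.
rewrite /unit_itv lebesgue_measure_itv /= lte_fin ltr_nat leqnn.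
by rewrite -EFinB -natrB // subSnn.
Qed.

Definition cell_index n (x : R) : nat := Num.truncn (n%:R * fracpart x).

Lemma cell_index_lt n x : (0 < n)%N -> (cell_index n x < n)%N.
Proof.
move=> n0; have /andP[f0 f1] := fracpart_itv x.
rewrite /cell_index -(ltr_nat R); apply: le_lt_trans (_ : n%:R * fracpart x < _).
  by rewrite truncn_le // mulr_ge0.
by rewrite gtr_pMr // ltr0n.
Qed.

Lemma measurable_cell_index n (i : nat) :
  measurable ([set x | cell_index n x = i] : set (measurableTypeR R)).
Proof.
have m1 : measurable_fun setT
    (fun x : measurableTypeR R => (cell_index n x)%:R : measurableTypeR R).
  apply: (@measurableT_comp _ _ _ _ _ _ (fun y : R => (Num.truncn y)%:R : R) _
            (fun x => n%:R * fracpart x)).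
    by apply: nondecreasing_measurable => // x y xy; rewrite ler_nat; exact: le_truncn.
  by apply: measurable_funM => //; exact: measurable_fracpart.
have := m1 measurableT [set i%:R]; rewrite setTI => /(_ (measurable_set1 _)).
congr measurable; apply/seteqP; split => x /=; last by move=> ->.
by move/eqP; rewrite eqr_nat => /eqP.
Qed.

Lemma cell_indexE n k (i : nat) : (0 < n)%N -> (i < n)%N ->
  [set x | cell_index n x = i] `&` unit_itv k =
  `[(k%:R + i%:R / n%:R), (k%:R + i.+1%:R / n%:R)[%classic :> set R.
Proof.
move=> n0 i_n; have n0' : 0 < n%:R :> R by rewrite ltr0n.
have fE (x : R) : k%:R <= x < k.+1%:R -> fracpart x = x - k%:R.
  move=> h; rewrite /fracpart.
  by have -> : Num.floor x = k%:Z by apply: floor_def; rewrite intrD -pmulrn natr1.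
have tE (x : R) : k%:R <= x < k.+1%:R ->
    (cell_index n x == i) = (k%:R + i%:R / n%:R <= x < k%:R + i.+1%:R / n%:R).
  move=> h; rewrite /cell_index (fE x h) truncn_eq; last first.
    by rewrite mulr_ge0 // subr_ge0; case/andP: h.
  by rewrite -lerBrDl -ltrBlDl ler_pdivrMr // ltr_pdivlMr // mulrC.
rewrite /unit_itv; apply/seteqP; split => x /=; rewrite !in_itv /=.
  by move=> [/eqP + h]; rewrite (tE x h).
move=> h; have h' : k%:R <= x < k.+1%:R.
  case/andP: h => h1 h2; apply/andP; split.
    by apply: le_trans h1; rewrite lerDl divr_ge0.
  apply: lt_le_trans h2 _; rewrite -[k.+1%:R]natr1 lerD2l ler_pdivrMr // mul1r ler_nat //.
by split=> //; apply/eqP; rewrite (tE x h').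
Qed.

(** Cuts every [k, k+1) into #|T| intervals of equal length labelled by the
    elements of T, so that the label of a uniform point is uniform on T; t0
    is the default value of [nth]. *)
Definition cell T (t0 : T) (x : R) : T := nth t0 (enum T) (cell_index #|T| x).

Lemma cell_sum T (t0 : T) (F : T -> R) x :
  F (cell t0 x) = \sum_(i < #|T|) F (nth t0 (enum T) i) * \1_[set x | cell_index #|T| x = i] x.
Proof.
have T0 : (0 < #|T|)%N by apply/card_gt0P; exists t0.
rewrite (bigD1 (Ordinal (cell_index_lt x T0))) //= indicE mem_set // mulr1.
rewrite big1 ?addr0 // => i /eqP ineq; rewrite indicE memNset ?mulr0 //= => e.
by apply: ineq; apply: val_inj.
Qed.

Lemma measurable_cell T (t0 : T) (F : T -> R) :
  measurable_fun setT (fun x : measurableTypeR R => F (cell t0 x)).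
Proof.
have -> : (fun x => F (cell t0 x)) = (fun x => \sum_(i < #|T|) F (nth t0 (enum T) i) *
   \1_[set x | cell_index #|T| x = i] x) by apply/funext => x; exact: cell_sum.
apply: measurable_sum => i; apply: measurable_funM => //.
by apply: measurable_indic; exact: measurable_cell_index.
Qed.

Lemma integral_cell k T (t0 : T) (F : T -> R) :
  (\int[mu]_(x in unit_itv k) (F (cell t0 x))%:E =
   (#|T|%:R^-1 * \sum_t F t)%:E)%E.
Proof.
have T0 : (0 < #|T|)%N by apply/card_gt0P; exists t0.
have T0' : 0 < #|T|%:R :> R by rewrite ltr0n.
pose A (i : nat) := [set x : measurableTypeR R | cell_index #|T| x = i].
have mA i : measurable (A i) by exact: measurable_cell_index.
under eq_integral do rewrite cell_sum -sumEFin.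
have mD := measurable_unit_itv k.
have iA i : mu.-integrable (unit_itv k) (EFin \o \1_(A i)).
  apply/integrableP; split; first by apply/measurable_EFinP; exact: measurable_indic.
  under eq_integral do rewrite /= ger0_norm //.
  rewrite integral_indic //.
  apply: (@le_lt_trans _ _ (mu (unit_itv k))); last by rewrite lebesgue_unit_itv ltry.
  by apply: le_measure; rewrite ?inE //; exact: measurableI.
rewrite integral_sum //; last first.
  move=> i; have := integrableZl mD (F (nth t0 (enum T) i)) (iA i).
  by apply: eq_integrable => // x _ /=; rewrite -EFinM.
transitivity (\sum_(i < #|T|) (F (nth t0 (enum T) i) * #|T|%:R^-1)%:E)%E.
  apply: eq_bigr => i _; under eq_integral do rewrite EFinM.
  rewrite (integralZl mD (iA i)) EFinM; congr (_ * _)%E.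
  rewrite integral_indic // cell_indexE // [LHS]lebesgue_measure_itv /= lte_fin.
  rewrite ltrD2l ltr_pM2r ?invr_gt0 // ltr_nat leqnn -EFinB; congr _%:E.
  by rewrite opprD addrACA subrr add0r -mulrBl -natrB // subSnn mul1r.
rewrite sumEFin; congr _%:E; rewrite -mulr_suml mulrC; congr (_ * _).
by rewrite -[RHS]big_enum (big_nth t0) big_mkord -cardE.
Qed.

Lemma unif_cell T (t0 : T) (F : T -> R) : (forall t, 0 <= F t) ->
  (\int[unif R]_x (F (cell t0 x))%:E = (#|T|%:R^-1 * \sum_t F t)%:E)%E.
Proof.
move=> F0; rewrite /unif integral_uniform //=; last 2 first.
- by apply/measurable_EFinP; exact: measurable_cell.
- by move=> x; rewrite lee_fin.
rewrite subr0 invr1 mul1e -(integral_itv_bndo_bndc); last first.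
  apply: measurable_funTS.
  by apply/measurable_EFinP; exact: measurable_cell.
by have := @integral_cell 0%N T t0 F; rewrite /unit_itv.
Qed.

End cells.

(** * Pairings with functions supported in a unit interval *)

Section unit_intervals.
Context (R : realType).
Local Notation mu := (@lebesgue_measure R).

#[local] Hint Extern 0 (measurable (unit_itv _)) => exact: measurable_unit_itv : core.

Lemma unit_itv_disjoint n m (x : R) : n != m -> unit_itv n x -> ~ unit_itv m x.
Proof.
rewrite /unit_itv /= !in_itv /= => nm /andP[n1 n2] /andP[m1 m2].
have := le_lt_trans n1 m2; have := le_lt_trans m1 n2.
by rewrite !ltr_nat !ltnS => h1 h2; move/negP: nm; apply; rewrite eqn_leq h1 h2.
Qed.

(** One summand for t <= l, the other for t > l.  The threshold l is free and
    is chosen after integration. *)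
Lemma powR_le_split (t a b l : R) : 0 <= t -> 0 < a -> a <= b -> 0 < l ->
  t `^ a <= l `^ a + t `^ b / l `^ (b - a).
Proof.
move=> t0 a0 ab l0; have [tl|lt] := leP t l.
  apply: ler_wpDr; first by rewrite divr_ge0 ?powR_ge0.
  by rewrite ge0_ler_powR ?nnegrE // ltW.
apply: ler_wpDl; first exact: powR_ge0.
rewrite ler_pdivlMr ?powR_gt0 //.
have -> : t `^ b = t `^ a * t `^ (b - a).
  by rewrite -powRD; [rewrite subrKC | rewrite (gt_eqF (lt_trans l0 lt)) implybT].
by rewrite ler_wpM2l ?powR_ge0 // ge0_ler_powR ?nnegrE ?subr_ge0 // ltW.
Qed.

Lemma measurable_norm_powR (D : set (measurableTypeR R)) (f : measurableTypeR R -> R) (a : R) :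
  measurable_fun setT f -> measurable_fun D (fun x => (`|f x| `^ a)%:E).
Proof.
move=> mf; apply: measurable_funTS.
apply/measurable_EFinP; apply: (measurableT_comp (measurable_powR _)) => //.
exact: measurableT_comp.
Qed.

(** Jensen's inequality up to a factor 2.  After integrating
    [powR_le_split], the choice l^a = c / 2 allows the first summand to be
    absorbed into the left-hand side. *)
Lemma unit_itv_jensen n (a b B : R) (f : measurableTypeR R -> R) :
  0 < a -> a <= b -> measurable_fun setT f ->
  (\int[mu]_(x in unit_itv n) (`|f x| `^ b)%:E <= B%:E)%E ->
  exists c : R, [/\ (\int[mu]_(x in unit_itv n) (`|f x| `^ a)%:E = c%:E)%E,
     0 <= c & c <= 2 * B `^ (a / b)].
Proof.
move=> a0 ab mf fB.
have b0 : 0 < b by apply: lt_le_trans ab.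
have bound (l : R) : 0 < l ->
    (\int[mu]_(x in unit_itv n) (`|f x| `^ a)%:E <= (l `^ a + B / l `^ (b - a))%:E)%E.
  move=> l0.
  apply: (@le_trans _ _ (\int[mu]_(x in unit_itv n)
      ((l `^ a)%:E + ((l `^ (b - a))^-1)%:E * (`|f x| `^ b)%:E))%E).
    apply: ge0_le_integral => //.
    - exact: measurable_norm_powR.
    - apply: emeasurable_funD => //; apply: emeasurable_funM => //.
      exact: measurable_norm_powR.
    - move=> x _; rewrite -EFinM -EFinD lee_fin [_^-1 * _]mulrC.
      exact: powR_le_split.
  rewrite ge0_integralD //; last 3 first.
  - by move=> x _; rewrite lee_fin powR_ge0.
  - by move=> x _; rewrite -EFinM lee_fin mulr_ge0 ?powR_ge0 // invr_ge0 powR_ge0.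
  - by apply: emeasurable_funM => //; exact: measurable_norm_powR.
  rewrite integral_cst //= lebesgue_unit_itv mule1 EFinD; apply: leeD2l.
  rewrite ge0_integralZl_EFin //; last 2 first.
  - exact: measurable_norm_powR.
  - by rewrite invr_ge0 powR_ge0.
  rewrite [B / _]mulrC EFinM; apply: lee_wpmul2l => //.
  by rewrite lee_fin invr_ge0 powR_ge0.
have c0 : (0 <= \int[mu]_(x in unit_itv n) (`|f x| `^ a)%:E)%E.
  by apply: integral_ge0 => x _; rewrite lee_fin powR_ge0.
have cfin : (\int[mu]_(x in unit_itv n) (`|f x| `^ a)%:E)%E \is a fin_num.
  by rewrite ge0_fin_numE //; apply: le_lt_trans (bound 1 _) (ltry _).
move: bound c0; rewrite -(fineK cfin); set c := fine _ => bound c0.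
rewrite lee_fin in c0; exists c; split => //.
move: c0; rewrite le_eqVlt => /predU1P[<-|c0]; first by rewrite mulr_ge0 // powR_ge0.
have c2 : 0 < c / 2 by rewrite divr_gt0.
(* The threshold for which the first summand of bound equals c / 2. *)
pose l := (c / 2) `^ a^-1.
have l0 : 0 < l by apply: powR_gt0.
have la : l `^ a = c / 2 by rewrite /l -powRrM mulVf ?gt_eqF // powRr1 // ltW.
have lB : l `^ b <= B.
  have := bound l l0; rewrite lee_fin la -lerBlDl.
  have -> : c - c / 2 = l `^ a by rewrite la; lra.
  rewrite ler_pdivlMr ?powR_gt0 // -powRD; last by rewrite (gt_eqF l0) implybT.
  by rewrite subrKC.
rewrite -[leLHS](@divfK _ 2) // mulrC ler_pM2l // -la.
have -> : l `^ a = (l `^ b) `^ (a / b) by rewrite -powRrM mulrCA mulfV ?gt_eqF // mulr1.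
rewrite ge0_ler_powR ?nnegrE ?powR_ge0 ?divr_ge0 // ?(ltW a0) ?(ltW b0) //.
by apply: le_trans lB; exact: powR_ge0.
Qed.

Context (r : R).
Hypothesis r1 : 1 <= r.
Local Notation Lr := (Lfun mu r%:E).
Local Notation N f := (fine ('N[mu]_(r%:E)[EFin \o f])).

Let r0 : 0 < r. Proof. exact: lt_le_trans r1. Qed.

Lemma unit_itv_integral_le n f : f \in Lr ->
  (\int[mu]_(x in unit_itv n) (`|f x| `^ r)%:E <= (N f `^ r)%:E)%E.
Proof.
move=> fL; rewrite -Lfun_integral_powR //.
apply: ge0_subset_integral => //.
- by apply: measurable_norm_powR; exact: Lfun_measurable fL.
Qed.

Section bump.
Context (n : nat) (h : measurableTypeR R -> R).
Hypothesis mh : measurable_fun setT h.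
Hypothesis h1 : forall x, `|h x| <= \1_(unit_itv n) x.

Lemma bump_integrable f : f \in Lr ->
  mu.-integrable setT (EFin \o (fun x => f x * h x)).
Proof.
move=> fL; have mf := Lfun_measurable fL.
apply: (@le_integrable _ _ _ mu setT measurableT _
   (fun x => (\1_(unit_itv n) x + `|f x| `^ r)%:E)).
- by apply/measurable_EFinP; exact: measurable_funM.
- move=> x _ /=; rewrite lee_fin normrM [leRHS]ger0_norm; last first.
    by rewrite addr_ge0 ?powR_ge0.
  apply: le_trans (ler_wpM2l _ (h1 x)) _ => //.
  rewrite indicE; case: (x \in _); last by rewrite mulr0 add0r powR_ge0.
  rewrite mulr1; have := @powR_le_split `|f x| 1 r 1 (normr_ge0 _) ltr01 r1 ltr01.
  by rewrite powRr1 // !powR1 divr1.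
- under eq_fun do rewrite EFinD.
  apply: integrableD => //.
    apply/integrableP; split; first by apply/measurable_EFinP; exact: measurable_indic.
    under eq_integral do rewrite /= ger0_norm //.
    by rewrite integral_indic //= setIT lebesgue_unit_itv ltry.
  apply/integrableP; split; first exact: measurable_norm_powR.
  under eq_integral do rewrite /= ger0_norm ?powR_ge0 //.
  by rewrite Lfun_integral_powR // ltry.
Qed.

Lemma bump_norm : ('N[mu]_(r%:E)[EFin \o h] <= 1)%E.
Proof.
have e1 : (1%E = 1%E `^ r^-1 :> \bar R)%E by rewrite poweR1r.
rewrite unlock [leRHS]e1.
have J0 : (0 <= \int[mu]_x (`|(EFin \o h) x| `^ r))%E.
  by apply: integral_ge0 => x _; exact: poweR_ge0.
apply: gt0_ler_poweR; rewrite ?in_itv /= ?leey ?andbT ?invr_ge0 ?(ltW r0) //.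
rewrite -(lebesgue_unit_itv R n) -(setIT (unit_itv n)) -integral_indic //.
apply: ge0_le_integral => //.
- exact: measurable_norm_powR.
- by apply/measurable_EFinP; exact: measurable_indic.
- move=> x _; rewrite lee_fin.
  apply: (@le_trans _ _ (\1_(unit_itv n) x `^ r)).
    by rewrite ge0_ler_powR ?nnegrE // ltW.
  by rewrite indicE; case: (x \in _); rewrite ?powR1 ?powR0 ?gt_eqF.
Qed.

Lemma bump_Lfun : h \in Lr.
Proof.
rewrite inE; apply/andP; split; rewrite inE //=.
by rewrite /finite_norm (le_lt_trans bump_norm) // ltry.
Qed.

Lemma pairing_bumpE f : pairing h f = (\int[mu]_(x in unit_itv n) (f x * h x))%R.
Proof.
rewrite /pairing [RHS]Rintegral_mkcond; apply: eq_Rintegral => x _.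
rewrite patchE; case: ifPn => // xn; have := h1 x.
by rewrite indicE (negbTE xn) normr_le0 => /eqP ->; rewrite mulr0.
Qed.

End bump.

Lemma pairing_disjoint n m (h h' : measurableTypeR R -> R) : n != m ->
  (forall x, `|h x| <= \1_(unit_itv n) x) ->
  (forall x, `|h' x| <= \1_(unit_itv m) x) -> pairing h h' = 0.
Proof.
move=> nm h1 h2; rewrite /pairing; under eq_Rintegral.
  move=> x _; have -> : h' x * h x = 0.
    have := h1 x; have := h2 x; rewrite !indicE.
    case: (boolP (x \in unit_itv n)) => [xn|_ _].
      rewrite memNset; last by apply: (unit_itv_disjoint nm); exact: set_mem.
      by rewrite normr_le0 => /eqP ->; rewrite mul0r.
    by rewrite normr_le0 => /eqP ->; rewrite mulr0.
  over.
by rewrite Rintegral_cst // mul0r.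
Qed.

Lemma indic_bump n (x : R) : `|\1_(unit_itv n) x| <= \1_(unit_itv n) x :> R.
Proof. by rewrite ger0_norm. Qed.

Lemma pairing_indic n : pairing (\1_(@unit_itv R n)) (\1_(unit_itv n)) = 1.
Proof.
rewrite (pairing_bumpE (@indic_bump n)) /Rintegral.
under eq_integral.
  move=> x xn; have -> : \1_(unit_itv n) x = 1 :> R by rewrite indicE xn.
  rewrite mulr1; over.
by rewrite integral_cst //= mul1e lebesgue_unit_itv.
Qed.

(** On each interval the r-th power of the pairing is at most 2^r times the
    integral of |f|^r over it, and the intervals are disjoint. *)
Lemma pairing_indic_le (I : finType) (n : I -> nat) f : injective n -> f \in Lr ->
  \sum_i `|pairing (\1_(unit_itv (n i))) f| `^ r <= (2 * N f) `^ r.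
Proof.
move=> ninj fL; have mf := Lfun_measurable fL.
have N0 : 0 <= N f by rewrite fine_ge0 // Lnorm_ge0.
have B0 i : (0 <= \int[mu]_(x in unit_itv (n i)) (`|f x| `^ r)%:E)%E.
  by apply: integral_ge0 => x _; rewrite lee_fin powR_ge0.
pose B i := fine (\int[mu]_(x in unit_itv (n i)) (`|f x| `^ r)%:E)%E.
have BE i : (\int[mu]_(x in unit_itv (n i)) (`|f x| `^ r)%:E = (B i)%:E)%E.
  by rewrite fineK // ge0_fin_numE //; apply: le_lt_trans (unit_itv_integral_le _ fL) (ltry _).
have sB : \sum_i B i <= N f `^ r.
  rewrite -lee_fin -sumEFin -Lfun_integral_powR //.
  under eq_bigr do rewrite -BE.
  under eq_bigr => i _ do rewrite integral_mkcond.
  rewrite -ge0_integral_sum //; last 2 first.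
  - by move=> i; apply/measurable_restrict => //; exact: measurable_norm_powR.
  - by move=> i x _; rewrite patchE; case: ifP => // _; rewrite lee_fin powR_ge0.
  apply: ge0_le_integral => //.
  - move=> x _; apply: sume_ge0 => i _.
    by rewrite patchE; case: ifP => // _; rewrite lee_fin powR_ge0.
  - by apply: emeasurable_sum => i; apply/measurable_restrict => //; exact: measurable_norm_powR.
  - exact: measurable_norm_powR.
  - move=> x _; have [[i xi]|nx] := pselect (exists i, unit_itv (n i) x).
      rewrite (bigD1 i) //= patchE mem_set // big1 ?adde0 // => j ji.
      rewrite patchE memNset //; apply: (unit_itv_disjoint _ xi).
      by rewrite eq_sym; apply: contra ji => /eqP /ninj ->.
    rewrite big1 ?lee_fin ?powR_ge0 // => i _.
    by rewrite patchE memNset // => xi; apply: nx; exists i.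
apply: (@le_trans _ _ (\sum_i 2 `^ r * B i)); last first.
  by rewrite -mulr_sumr powRM // ler_wpM2l ?powR_ge0.
apply: ler_sum => i _.
have B0' : 0 <= B i by rewrite fine_ge0.
have [|c [cE c0 cB]] := @unit_itv_jensen (n i) 1 r (B i) f ltr01 r1 mf; first by rewrite BE.
have -> : 2 `^ r * B i = (2 * B i `^ (1 / r)) `^ r.
  by rewrite powRM ?powR_ge0 // -powRrM div1r mulVf ?gt_eqF // powRr1.
rewrite ge0_ler_powR ?nnegrE ?mulr_ge0 ?powR_ge0 // ?(ltW r0) //.
apply: le_trans cB.
rewrite (pairing_bumpE (@indic_bump _)).
rewrite -lee_fin -cE EFin_normr_Rintegral //; last first.
  have := bump_integrable _ (@indic_bump (n i)) fL.
  by move=> /(_ (measurable_indic _)) H; apply: integrableS (H _).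
have mfh : measurable_fun (unit_itv (n i)) (fun x => (f x * \1_(unit_itv (n i)) x)%:E).
  by apply: measurable_funTS; apply/measurable_EFinP; apply: measurable_funM.
apply: le_trans (le_abse_integral _ _ mfh) _ => //.
apply: ge0_le_integral => //.
- exact: measurableT_comp.
- exact: measurable_norm_powR.
- by move=> x xn; rewrite /= lee_fin indicE mem_set // mulr1 powRr1.
Qed.

End unit_intervals.

(** * Random signs *)

Section signs.
Context (R : realType) (I : finType).
Local Notation Omega := {ffun I -> bool}.

(** For distinct i and j, flipping the i-th sign reverses the sum. *)
Lemma sum_signs (i j : I) :
  \sum_(w : Omega) (-1) ^+ (w i) * (-1) ^+ (w j) = (#|{ffun I -> bool}| * (i == j))%:R :> R.
Proof.
have [->|ij] := eqVneq i j.
  under eq_bigr do rewrite -expr2 sqrr_sign.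
  by rewrite sumr_const muln1.
rewrite muln0.
pose flip (w : Omega) : Omega := [ffun k => if k == i then ~~ w k else w k].
have flipK : involutive flip.
  by move=> w; apply/ffunP => k; rewrite !ffunE; case: (k == i); rewrite ?negbK.
set S := \sum_w _.
have : S = - S.
  rewrite {1}/S (reindex_inj (inv_inj flipK)) -sumrN; apply: eq_bigr => w _.
  by rewrite !ffunE eqxx eq_sym (negbTE ij) signrN mulNr.
by move=> /eqP; rewrite -addr_eq0 -mulr2n mulrn_eq0 => /eqP.
Qed.

Lemma sum_signs_sqr (a : I -> R) :
  \sum_(w : Omega) (\sum_i a i * (-1) ^+ (w i)) ^+ 2 = #|{ffun I -> bool}|%:R * \sum_i a i ^+ 2.
Proof.
transitivity (\sum_i \sum_j a i * a j * \sum_(w : Omega) (-1) ^+ (w i) * (-1) ^+ (w j)).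
  under [RHS]eq_bigr do under eq_bigr do rewrite mulr_sumr.
  under [RHS]eq_bigr do rewrite exchange_big.
  rewrite [RHS]exchange_big; apply: eq_bigr => w _.
  rewrite expr2 mulr_suml; apply: eq_bigr => i _.
  by rewrite mulr_sumr; apply: eq_bigr => j _; rewrite mulrACA.
rewrite mulr_sumr; apply: eq_bigr => i _.
rewrite (bigD1 i) //= [X in _ + X]big1 ?addr0; last first.
  by move=> j /negbTE ji; rewrite sum_signs eq_sym ji muln0 mulr0.
by rewrite sum_signs eqxx muln1 mulrC expr2.
Qed.

End signs.

Section rademacher.
Context (R : realType) (r : R) (I : finType).
Hypothesis r2 : 2 <= r.
Local Notation mu := (@lebesgue_measure R).
Local Notation Lr := (Lfun mu r%:E).
Local Notation N f := (fine ('N[mu]_(r%:E)[EFin \o f])).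
Local Notation Omega := {ffun I -> bool}.

Let r1 : 1 <= r. Proof. by apply: le_trans r2; rewrite ler1n. Qed.
Let r0 : 0 < r. Proof. exact: lt_le_trans r1. Qed.

Let w0 : Omega := [ffun=> false].

Definition rademacher n (i : I) (x : measurableTypeR R) : R :=
  \1_(unit_itv n) x * (-1) ^+ (cell w0 x i).

Lemma measurable_rademacher n i : measurable_fun setT (rademacher n i).
Proof.
apply: measurable_funM; first exact: (measurable_indic (measurable_unit_itv n)).
exact: (measurable_cell w0 (fun w => (-1) ^+ (w i) : R)).
Qed.

Lemma rademacher_bump n i x : `|rademacher n i x| <= \1_(unit_itv n) x.
Proof. by rewrite normrM normr_sign mulr1 ger0_norm. Qed.

Let pairing_onE n i f : pairing (rademacher n i) f =
  (\int[mu]_(x in unit_itv n) (f x * (-1) ^+ (cell w0 x i)))%R.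
Proof.
rewrite (pairing_bumpE (@rademacher_bump n i)).
by apply: eq_Rintegral => x xn; rewrite /rademacher indicE xn mul1r.
Qed.

Lemma pairing_rademacher n i j : pairing (rademacher n i) (rademacher n j) = (i == j)%:R.
Proof.
rewrite pairing_onE /Rintegral.
have -> : (\int[mu]_(x in unit_itv n) (rademacher n j x * (-1) ^+ cell w0 x i)%:E =
           (#|{ffun I -> bool}|%:R^-1 * \sum_(w : Omega) (-1) ^+ (w i) * (-1) ^+ (w j))%:E)%E.
  rewrite -(integral_cell n w0); apply: eq_integral => x xn.
  by rewrite /rademacher indicE xn mul1r mulrC.
rewrite /= sum_signs natrM mulrA mulVf ?mul1r //.
by rewrite pnatr_eq0 -lt0n; apply/card_gt0P; exists w0.
Qed.

(** Bessel's inequality: F below is the orthogonal projection of f onto the span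
    of the signs, and (f - F)^2 >= 0.  Since 2 <= r, the norm of f in L^2 of
    the unit interval is controlled by its norm in L^r. *)
Lemma pairing_rademacher_le n f : f \in Lr ->
  \sum_i `|pairing (rademacher n i) f| `^ 2 <= (2 * N f) `^ 2.
Proof.
move=> fL; have mf := Lfun_measurable fL.
have N0 : 0 <= N f by rewrite fine_ge0 // Lnorm_ge0.
have [|c [cE c0 cB]] := @unit_itv_jensen R n 2 r (N f `^ r) f (ltr0n _ 2) r2 mf.
  exact: unit_itv_integral_le.
pose a i := pairing (rademacher n i) f.
pose F (w : Omega) := \sum_i a i * (-1) ^+ (w i).
have mD : measurable (@unit_itv R n) by exact: measurable_unit_itv.
have iD i : mu.-integrable (@unit_itv R n) (fun x => (f x * (-1) ^+ (cell w0 x i))%:E).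
  have H := bump_integrable r1 (measurable_rademacher n i) (@rademacher_bump n i) fL.
  have := integrableS measurableT mD (@subsetT _ _) H.
  by apply: eq_integrable => // x xn /=; rewrite /rademacher indicE xn mul1r.
have aE i : (\int[mu]_(x in unit_itv n) (f x * (-1) ^+ (cell w0 x i))%:E)%E = (a i)%:E.
  by rewrite /a pairing_onE /Rintegral fineK //; exact: integrable_fin_num.
have i2 : mu.-integrable (@unit_itv R n) (fun x => (`|f x| `^ 2)%:E).
  apply/integrableP; split; first exact: measurable_norm_powR.
  under eq_integral do rewrite /= ger0_norm ?powR_ge0 //.
  by rewrite cE ltry.
have FE : (\int[mu]_(x in unit_itv n) (F (cell w0 x) ^+ 2)%:E)%E = (\sum_i a i ^+ 2)%:E.
  rewrite (integral_cell n w0 (fun w => F w ^+ 2)) sum_signs_sqr mulrA mulVf ?mul1r //.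
  by rewrite pnatr_eq0 -lt0n; apply/card_gt0P; exists w0.
have iF : mu.-integrable (@unit_itv R n) (fun x => (F (cell w0 x) ^+ 2)%:E).
  apply/integrableP; split.
    apply: measurable_funTS; apply/measurable_EFinP.
    exact: (measurable_cell w0 (fun w => F w ^+ 2)).
  under eq_integral do rewrite /= ger0_norm ?sqr_ge0 //.
  by rewrite FE ltry.
have ifs i : mu.-integrable (@unit_itv R n)
    (fun x => (2 * a i)%:E * (f x * (-1) ^+ (cell w0 x i))%:E)%E.
  exact: integrableZl.
have fFE : (\int[mu]_(x in unit_itv n) (2 * (f x * F (cell w0 x)))%:E)%E = (2 * \sum_i a i ^+ 2)%:E.
  transitivity (\int[mu]_(x in unit_itv n)
      (\sum_i (2 * a i)%:E * (f x * (-1) ^+ (cell w0 x i))%:E))%E.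
    apply: eq_integral => x _; under eq_bigr do rewrite -EFinM.
    rewrite sumEFin /F !mulr_sumr; congr _%:E; apply: eq_bigr => i _; ring.
  rewrite integral_sum // mulr_sumr -sumEFin; apply: eq_bigr => i _.
  by rewrite integralZl // aE -EFinM -mulrA.
have ifF : mu.-integrable (@unit_itv R n) (fun x => (2 * (f x * F (cell w0 x)))%:E).
  have := integrable_sum mD (index_enum I) (P := xpredT) (fun i _ => ifs i).
  apply: eq_integrable => // x _ /=; under eq_bigr do rewrite -EFinM.
  rewrite sumEFin /F !mulr_sumr; congr _%:E; apply: eq_bigr => i _; ring.
have key : \sum_i a i ^+ 2 <= c.
  suff : 2 * \sum_i a i ^+ 2 <= c + \sum_i a i ^+ 2 by lra.
  rewrite -lee_fin -fFE EFinD -cE -FE -integralD //.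
  apply: le_integral => //; first exact: integrableD.
  move=> x _; rewrite -EFinD lee_fin powR_mulrn // real_normK ?num_real //.
  have := sqr_ge0 (f x - F (cell w0 x)); rewrite sqrrB; lra.
under eq_bigr do rewrite powR_mulrn // real_normK ?num_real //.
apply: (le_trans key); apply: (le_trans cB).
rewrite -powRrM mulrCA mulfV ?gt_eqF // mulr1 !powR_mulrn // ?mulr_ge0 //.
have := sqr_ge0 (N f); rewrite exprMn; lra.
Qed.

End rademacher.

(** * Finite models: spikes *)

Section finite_levels.
Context (R : realType).

(** For s > 0 this is scaling; for s = 0 all the a i vanish. *)
Lemma finite_level_homogeneous (I T : finType) (G : I -> T -> R) (rho p C : R) :
  0 < rho -> 0 < p ->
  (forall a : I -> R, \sum_i `|a i| `^ rho <= 1 ->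
     \sum_t `|\sum_i a i * G i t| `^ p <= C) ->
  forall (a : I -> R) (s : R), 0 <= s -> \sum_i `|a i| `^ rho <= s `^ rho ->
     \sum_t `|\sum_i a i * G i t| `^ p <= C * s `^ p.
Proof.
move=> rho0 p0 H a s; rewrite le_eqVlt => /predU1P[<-|s0] ha.
  rewrite powR0 ?gt_eqF // mulr0 big1 // => t _.
  rewrite big1 ?normr0 ?powR0 ?gt_eqF // => i _.
  have : `|a i| `^ rho = 0.
    apply/eqP; rewrite eq_le powR_ge0 andbT; apply: le_trans _ (_ : 0 `^ rho <= 0).
      apply: le_trans ha; rewrite (bigD1 i) //= lerDl.
      by apply: sumr_ge0 => j _; exact: powR_ge0.
    by rewrite powR0 ?gt_eqF.
  by move=> /powR_eq0_eq0 /eqP; rewrite normr_eq0 => /eqP ->; rewrite mul0r.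
have nV : `|s^-1| = s^-1 by rewrite ger0_norm // invr_ge0 ltW.
have := H (fun i => s^-1 * a i).
have E1 : \sum_i `|s^-1 * a i| `^ rho <= 1.
  under eq_bigr do rewrite normrM nV powRM ?invr_ge0 ?(ltW s0) //.
  rewrite -mulr_sumr -powR_inv1 ?(ltW s0) // -powRrM mulN1r powRN.
  by rewrite ler_pdivrMl ?powR_gt0 // mulr1.
move=> /(_ E1).
under eq_bigr do under eq_bigr do rewrite -mulrA.
under eq_bigr do rewrite -mulr_sumr normrM nV powRM ?invr_ge0 ?(ltW s0) //.
rewrite -mulr_sumr -powR_inv1 ?(ltW s0) // -powRrM mulN1r powRN.
by rewrite ler_pdivrMl ?powR_gt0 // mulrC.
Qed.

(** A level of size 2^(k^2) outgrows the inverse 4^(k+1) of its weight,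
    whatever the powers to which both are raised. *)
Lemma level_growth (p delta B : R) : 0 < p -> 0 < delta ->
  exists k : nat, B <= (4^-1 ^+ k.+1) `^ p * ((2 ^ (k ^ 2))%:R) `^ delta.
Proof.
move=> p0 d0.
pose k := (Num.truncn `|B| + Num.truncn ((4 * p + 1) / delta)).+1.
exists k.
have kB : B <= k%:R.
  apply: le_trans (ler_norm _) _; apply: le_trans (ltW (truncnS_gt _)) _.
  by rewrite ler_nat ltnS leq_addr.
have kd : 4 * p + 1 <= k%:R * delta.
  rewrite -ler_pdivrMr //; apply: le_trans (ltW (truncnS_gt _)) _.
  by rewrite ler_nat ltnS leq_addl.
apply: (le_trans kB).
have k1 : 1 <= k%:R :> R by rewrite ler1n.
apply: (@le_trans _ _ (2 `^ k%:R)).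
  by rewrite powR_mulrn // -natrX ler_nat; apply: ltnW; exact: ltn_expl.
have -> : (4^-1 ^+ k.+1) `^ p = 2 `^ (- (2 * k.+1%:R * p)) :> R.
  have -> : (4^-1 ^+ k.+1 : R) = 2 `^ (- (2 * k.+1%:R)).
    rewrite powRN -natrM powR_mulrn // exprVn exprM; congr ((_ ^+ _)^-1).
    by rewrite expr2 -natrM.
  by rewrite -powRrM mulNr.
have -> : (2 ^ (k ^ 2))%:R `^ delta = 2 `^ ((k%:R ^+ 2) * delta) :> R.
  by rewrite powRrM -natrX powR_mulrn // natrX.
rewrite -powRD; last by rewrite pnatr_eq0 implybT.
rewrite ler_powR ?ler1n //.
rewrite -natr1; nra.
Qed.

Section spike.
Context (I : finType) (rho q : R).
Hypothesis rho0 : 0 < rho.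
Hypothesis rhoq : rho <= q.

Let q0 : 0 < q. Proof. exact: lt_le_trans rhoq. Qed.

(** Normalized so that the q-th power of a spike has mean 1 over t. *)
Definition spike (i t : I) : R := #|I|%:R `^ q^-1 * (t == i)%:R.

Let sum_spike (a : I -> R) t : \sum_i a i * spike i t = a t * #|I|%:R `^ q^-1.
Proof.
rewrite (bigD1 t) //= /spike eqxx mulr1 big1 ?addr0 // => i /negbTE it.
by rewrite eq_sym it !mulr0.
Qed.

(** The spikes have disjoint supports, so at p = q the left-hand side is #|I|
    times the sum of the |a_i|^q, and |a_i|^q <= |a_i|^rho because |a_i| <= 1.
    Smaller p follow from t^p <= 1 + t^q. *)
Lemma spike_le (p : R) (a : I -> R) : 0 < p -> p <= q ->
  \sum_i `|a i| `^ rho <= 1 -> \sum_t `|\sum_i a i * spike i t| `^ p <= 2 * #|I|%:R.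
Proof.
move=> p0 pq ha.
have a1 i : `|a i| <= 1.
  rewrite leNgt; apply/negP => ai; move: ha; apply/negP; rewrite -ltNge.
  rewrite (bigD1 i) //=; apply: ltr_wpDr; first by apply: sumr_ge0 => j _; exact: powR_ge0.
  have e1 : (1 : R) `^ rho = 1 by rewrite powR1.
  by rewrite -[ltLHS]e1; apply: gt0_ltr_powR; rewrite ?nnegrE.
have aq : \sum_i `|a i| `^ q <= 1.
  apply: le_trans ha; apply: ler_sum => i _.
  have [->|ai] := eqVneq (`|a i|) 0; first by rewrite !powR0 ?gt_eqF.
  by apply: ger_powR => //; rewrite a1 andbT lt0r ai /=.
apply: (@le_trans _ _ (\sum_t (1 + #|I|%:R * `|a t| `^ q))).
  apply: ler_sum => t _; rewrite sum_spike.
  apply: (@le_trans _ _ (1 `^ p + `|a t * #|I|%:R `^ q^-1| `^ q / 1 `^ (q - p))).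
    exact: powR_le_split.
  rewrite !powR1 divr1 normrM powRM // (ger0_norm (powR_ge0 _ _)) -powRrM mulVf ?gt_eqF //.
  by rewrite powRr1 // mulrC.
rewrite big_split /= -mulr_sumr sumr_const mulr2n mulrDl mul1r lerD2l.
by rewrite -[leRHS]mulr1 ler_wpM2l.
Qed.

Lemma spike_ge (p c B : R) (t : I) : 0 < p -> 0 <= c ->
  B <= c `^ p * #|I|%:R `^ (p / q - 1) ->
  #|I|%:R * B <= \sum_i (c * `|spike i t|) `^ p.
Proof.
move=> p0 c0 HB.
have I0 : 0 < #|I|%:R :> R by rewrite ltr0n; apply/card_gt0P; exists t.
rewrite (bigD1 t) //= ler_wpDr //; first by apply: sumr_ge0 => i _; exact: powR_ge0.
rewrite /spike eqxx mulr1 ger0_norm ?powR_ge0 // powRM ?powR_ge0 // -powRrM.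
have -> : q^-1 * p = 1 + (p / q - 1) by rewrite subrKC mulrC.
rewrite powRD; last by rewrite (gt_eqF I0) implybT.
by rewrite powRr1 // ?(ltW I0) // mulrCA ler_wpM2l // ltW.
Qed.

End spike.

End finite_levels.

(** * Finite models: discrete stable variables *)

Section dyadic.
Context (R : realType).

Lemma count_modn (a b c : nat) : (c < b)%N ->
  (\sum_(y < a * b) (y %% b == c) = a)%N.
Proof.
move=> cb; rewrite -(big_mkord xpredT (fun y => nat_of_bool (y %% b == c)%N)).
elim: a => [|a IH]; first by rewrite mul0n big_nil.
rewrite mulSnr (@big_cat_nat _ _ _ (a * b)) ?leq_addr //= IH -addn1; congr (_ + _)%N.
rewrite -{1}[(a * b)%N]add0n big_addn addnC addnK big_mkord.
rewrite (bigD1 (Ordinal cb)) //= [(c + a * b)%N]addnC modnMDl modn_small // eqxx big1 // => i.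
rewrite -val_eqE /= => /negbTE ic.
by rewrite [(i + a * b)%N]addnC modnMDl modn_small // ic.
Qed.

(** The inverse of the 2-adic distance from i to y, truncated at 2^n.  For
    fixed i and uniform y below 2^n it exceeds lambda with probability of
    order 1 / lambda. *)
Definition dyadic_proximity (i y : nat) (n : nat) : nat :=
  \max_(j < n.+1 | i == y %[mod 2 ^ j]) 2 ^ j.

Lemma dyadic_proximityP i y n :
  exists2 j : 'I_n.+1, i == y %[mod 2 ^ j] & dyadic_proximity i y n = (2 ^ j)%N.
Proof.
have [|j jA E] := @eq_bigmax_cond _
  [pred j : 'I_n.+1 | i == y %[mod 2 ^ j]] (fun j => 2 ^ j)%N.
  by apply/card_gt0P; exists ord0; rewrite inE /= !modn1.
exists j; first by rewrite inE in jA.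
by rewrite -E /dyadic_proximity; apply: eq_bigl => k; rewrite inE.
Qed.

Lemma dyadic_proximity_gt0 i y n : (0 < dyadic_proximity i y n)%N.
Proof. by have [j _ ->] := dyadic_proximityP i y n; rewrite expn_gt0. Qed.

Lemma count_congruent n (c : nat) (j : 'I_n.+1) :
  (\sum_(y < 2 ^ n) (c == y %[mod 2 ^ j]) = 2 ^ (n - j))%N.
Proof.
have E : (2 ^ n = 2 ^ (n - j) * 2 ^ j)%N by rewrite -expnD subnK // -ltnS.
have := @count_modn (2 ^ (n - j)) (2 ^ j) (c %% 2 ^ j).
rewrite -E ltn_mod expn_gt0 /= => /(_ isT) <-.
by apply: eq_bigr => y _; rewrite eq_sym.
Qed.

(** The n+1 congruences modulo 2^j contribute 2^j 2^(n-j) = 2^n each, and the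
    powers of two up to 2^j0 add up to less than 2^(j0+1). *)
Lemma sum_dyadic_proximity_ge n (y : nat) :
  (2 ^ n * n.+1 <= 2 * \sum_(i < 2 ^ n) dyadic_proximity i y n)%N.
Proof.
have -> : (2 ^ n * n.+1 = \sum_(j < n.+1) 2 ^ j * \sum_(i < 2 ^ n) (i == y %[mod 2 ^ j]))%N.
  rewrite -[in LHS](card_ord n.+1) mulnC -sum_nat_const; apply: eq_bigr => j _.
  rewrite (eq_bigr (fun i : 'I_(2 ^ n) => nat_of_bool (y == i %[mod 2 ^ j])));
    last by move=> i _; rewrite eq_sym.
  by rewrite count_congruent -expnD subnKC // -ltnS.
under eq_bigr do rewrite big_distrr.
rewrite exchange_big /= big_distrr /=; apply: leq_sum => i _.
have [j0 _ v0] := dyadic_proximityP i y n.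
apply: (@leq_trans (\sum_(j < n.+1 | (j <= j0)%N) 2 ^ j)).
  rewrite [leqRHS]big_mkcond /=; apply: leq_sum => j _.
  case: (boolP (i == y %[mod 2 ^ j])) => [ij|_]; last by rewrite muln0.
  rewrite muln1; case: ifPn => //; rewrite -ltnNge => jj.
  have : (2 ^ j <= dyadic_proximity i y n)%N.
    by apply: (@leq_bigmax_cond _ _ (fun j : 'I_n.+1 => 2 ^ j)%N).
  by rewrite v0 leq_exp2l // leqNgt jj.
rewrite v0 -(big_mkord (fun j => (j <= j0)%N) (fun j => 2 ^ j)%N).
have jn : (j0.+1 <= n.+1)%N by [].
rewrite (big_cat_nat (n := j0.+1)) //= [X in (_ + X)%N]big1_seq ?addn0; last first.
  by move=> j /andP[jj]; rewrite mem_index_iota => /andP[]; rewrite ltnNge jj.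
rewrite big_mkord -expnS.
apply: (@leq_trans (\sum_(j < j0.+1) 2 ^ j)).
  by rewrite [leqLHS]big_mkcond /=; apply: leq_sum => j _; case: ifP.
have : (\sum_(j < j0.+1) 2 ^ j).+1 = (2 ^ j0.+1)%N.
  elim: (j0.+1) => [|m IH]; first by rewrite big_ord0.
  by rewrite big_ord_recr /= -addSn IH expnS mul2n addnn.
by move=> <-.
Qed.

Context (r p : R).
Hypothesis p0 : 0 < p.
Hypothesis pr : p < r.
Hypothesis r2 : r < 2.

Let r0 : 0 < r. Proof. exact: lt_trans pr. Qed.
Let s : R := Num.min (2 / r - 1) (1 - p / r).
Let s0 : 0 < s.
Proof.
by rewrite /s lt_min !subr_gt0 ltr_pdivlMr // mul1r r2 ltr_pdivrMr // mul1r.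
Qed.

(** The minimum of w^(2/r) and w^(p/r), since p < 2. *)
Definition min_power (w : R) : R := if w <= 1 then w `^ (2 / r) else w `^ (p / r).

Lemma min_power_ge0 w : 0 <= min_power w.
Proof. by rewrite /min_power; case: ifP => _; exact: powR_ge0. Qed.

(** With u = w^s, the quotient of min_power w by w is at most min(u, 1/u), which
    is comparable to u / (1 + u)^2.  Unlike the minimum, this function is
    dominated by the increments of u / (1 + u) along geometric progressions. *)
Lemma min_power_le (w : R) : 0 < w -> min_power w <= w * (4 * w `^ s / (1 + w `^ s) ^+ 2).
Proof.
move=> w0; set u := w `^ s; have u0 : 0 < u by apply: powR_gt0.
have d0 : 0 < (1 + u) ^+ 2 by rewrite exprn_gt0 // addr_gt0.
rewrite /min_power; case: (leP w 1) => w1;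
  rewrite -mulr_powRB1 ?(ltW w0) ?divr_gt0 // ler_pM2l // ler_pdivlMr //.
- have u1 : u <= 1.
    have e1 : (1 : R) `^ s = 1 by rewrite powR1.
    by rewrite -e1 ge0_ler_powR ?nnegrE // ltW.
  have : w `^ (2 / r - 1) <= u by apply: ger_powR; rewrite ?w0 // /s ge_min lexx.
  have := powR_ge0 w (2 / r - 1); nra.
- have u1 : 1 <= u.
    have e1 : (1 : R) `^ s = 1 by rewrite powR1.
    by rewrite -e1 ge0_ler_powR ?nnegrE // ltW.
  have h : w `^ (p / r - 1) <= u^-1.
    rewrite -powRN; apply: ler_powR; first exact: ltW.
    by rewrite lerNr opprB /s ge_min lexx orbT.
  apply: le_trans (ler_wpM2r (ltW d0) h) _.
  by rewrite ler_pdivrMl //; nra.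
Qed.

Let rho : R := 2 `^ s.
Let rho1 : 1 < rho.
Proof.
have e1 : (1 : R) `^ s = 1 by rewrite powR1.
by rewrite -e1 gt0_ltr_powR ?nnegrE // ltr1n.
Qed.

Let Cmin : R := 4 / (1 - rho^-1).

Let Cmin_gt0 : 0 < Cmin.
Proof. by rewrite divr_gt0 // subr_gt0 invf_lt1 // (lt_trans ltr01). Qed.

Let G (u : R) := u / (1 + u).

Lemma kernel_le (u : R) : 0 < u ->
  4 * u / (1 + u) ^+ 2 <= Cmin * (G u - G (u / rho)).
Proof.
move=> u0; have rho0 : 0 < rho by apply: lt_trans rho1.
have ri : rho^-1 < 1 by rewrite invf_lt1.
have ri0 : 0 < rho^-1 by rewrite invr_gt0.
rewrite /Cmin /G; set x := rho^-1 in ri ri0 *.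
have d1 : 0 < 1 + u by rewrite addr_gt0.
have d2 : 0 < 1 + u * x by rewrite addr_gt0 // mulr_gt0.
have d3 : 0 < 1 - x by rewrite subr_gt0.
have -> : 4 / (1 - x) * (u / (1 + u) - u * x / (1 + u * x)) = 4 * u / ((1 + u) * (1 + u * x)).
  by field; rewrite !gt_eqF.
rewrite ler_pM2l ?mulr_gt0 // lef_pV2 ?posrE ?exprn_gt0 ?mulr_gt0 //.
rewrite expr2 ler_pM2l // lerD2l; nra.
Qed.

(** The increments of G telescope, and G takes its values in [0, 1]. *)
Lemma sum_min_power_le (b : R) (m : nat) : 0 <= b ->
  \sum_(j < m) (2 ^+ j)^-1 * min_power (b * 2 ^+ j) <= Cmin * b.
Proof.
rewrite le_eqVlt => /predU1P[<-|b0].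
  rewrite mulr0 big1 // => j _; rewrite mul0r /min_power ler01 powR0 ?mulr0 //.
  by rewrite gt_eqF // divr_gt0.
have rho0 : 0 < rho by apply: lt_trans rho1.
(* v j.+1 = (b 2^j)^s; the shift makes the increments telescope from v 0. *)
pose v j : R := b `^ s * rho ^+ j / rho.
have v0 j : 0 < v j by rewrite divr_gt0 // mulr_gt0 ?powR_gt0 // exprn_gt0.
apply: (@le_trans _ _ (\sum_(0 <= j < m) b * Cmin * (G (v j.+1) - G (v j)))).
  rewrite big_mkord; apply: ler_sum => j _.
  have t0 : 0 < 2 ^+ j :> R by rewrite exprn_gt0.
  rewrite ler_pdivrMl //; apply: le_trans (min_power_le (mulr_gt0 b0 t0)) _.
  have -> : (b * 2 ^+ j) `^ s = v j.+1.
    rewrite /v exprS powRM ?(ltW b0) ?(ltW t0) // [rho * _]mulrC mulrA mulfK ?gt_eqF //.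
    by congr (_ * _); rewrite /rho -!powR_mulrn ?powR_ge0 // powRAC.
  have -> : v j = v j.+1 / rho by rewrite /v exprS; field; rewrite gt_eqF.
  have -> : 2 ^+ j * (b * Cmin * (G (v j.+1) - G (v j.+1 / rho))) =
            (b * 2 ^+ j) * (Cmin * (G (v j.+1) - G (v j.+1 / rho))) by ring.
  by rewrite ler_wpM2l ?kernel_le // mulr_ge0 // ltW.
rewrite -mulr_sumr telescope_sumr // [b * _]mulrC -[leRHS]mulr1.
rewrite ler_wpM2l //; first by rewrite mulr_ge0 // ltW.
rewrite lerBlDr ler_wpDr //; first by rewrite /G divr_ge0 ?addr_ge0 // ltW.
by rewrite /G ler_pdivrMr ?addr_gt0 // mul1r lerDr.
Qed.

(** Each term is at most min_power (w i) D^(2/p - 1), where D is the right-hand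
    side: for w i <= 1 because D >= 1, and for w i > 1 because w^(2/r) is then
    the power 2/p of min_power w.  Hence the sum is at most D^(2/p). *)
Lemma square_sum_le (I : finType) (w : I -> R) : (forall i, 0 <= w i) ->
  (\sum_i w i `^ (2 / r)) `^ (p / 2) <= 1 + \sum_i min_power (w i).
Proof.
move=> w0; set D := 1 + _.
have D1 : 1 <= D by rewrite lerDl; apply: sumr_ge0 => i _; exact: min_power_ge0.
have D0 : 0 < D by apply: lt_le_trans D1.
have e0 : 0 <= 2 / p - 1 by rewrite subr_ge0 ler_pdivlMr // mul1r ltW // (lt_trans pr r2).
have De : 1 <= D `^ (2 / p - 1).
  have e1 : (1 : R) `^ (2 / p - 1) = 1 by rewrite powR1.
  by rewrite -[leLHS]e1 ge0_ler_powR ?nnegrE // ltW.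
have term i : w i `^ (2 / r) <= min_power (w i) * D `^ (2 / p - 1).
  have [w1|w1] := leP (w i) 1.
    by rewrite {1}/min_power w1 -[leLHS]mulr1 ler_wpM2l ?powR_ge0.
  have wp : 0 < min_power (w i) by rewrite /min_power leNgt w1 /= powR_gt0 // (lt_trans ltr01).
  have -> : w i `^ (2 / r) = min_power (w i) * min_power (w i) `^ (2 / p - 1).
    rewrite mulr_powRB1 ?(ltW wp) ?divr_gt0 // /min_power leNgt w1 /= -powRrM; congr (_ `^ _).
    by field; rewrite !gt_eqF.
  rewrite ler_pM2l // ge0_ler_powR ?nnegrE ?(ltW wp) ?(ltW D0) //.
  rewrite /D (bigD1 i) //= addrCA lerDl addr_ge0 //.
  by apply: sumr_ge0 => j _; exact: min_power_ge0.
have : \sum_i w i `^ (2 / r) <= D `^ (2 / p).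
  apply: (@le_trans _ _ (D * D `^ (2 / p - 1))).
    apply: (@le_trans _ _ ((\sum_i min_power (w i)) * D `^ (2 / p - 1))).
      by rewrite mulr_suml; apply: ler_sum.
    by rewrite ler_wpM2r ?powR_ge0 // lerDr.
  by rewrite mulr_powRB1 ?(ltW D0) ?divr_gt0.
move=> H; apply: (@le_trans _ _ ((D `^ (2 / p)) `^ (p / 2))).
  rewrite ge0_ler_powR ?nnegrE ?powR_ge0 ?divr_ge0 ?(ltW p0) //.
  by apply: sumr_ge0 => i _; exact: powR_ge0.
rewrite -powRrM (_ : 2 / p * (p / 2) = 1) ?powRr1 ?(ltW D0) //.
by field; rewrite gt_eqF.
Qed.

Lemma sum_min_power_proximity_le n (b : R) (i : nat) : 0 <= b ->
  \sum_(y < 2 ^ n) min_power (b * (dyadic_proximity i y n)%:R) <= Cmin * b * (2 ^ n)%:R.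
Proof.
move=> b0.
apply: (@le_trans _ _ (\sum_(y < 2 ^ n) \sum_(j < n.+1)
    min_power (b * 2 ^+ j) * (i == y %[mod 2 ^ j])%:R)).
  apply: ler_sum => y _; have [j ij ->] := dyadic_proximityP i y n.
  rewrite (bigD1 j) //= ij mulr1 natrX lerDl; apply: sumr_ge0 => k _.
  by rewrite mulr_ge0 ?min_power_ge0.
rewrite exchange_big /=.
under eq_bigr => j _ do rewrite -mulr_sumr -natr_sum count_congruent.
apply: le_trans (ler_wpM2r _ (sum_min_power_le n.+1 b0)) => //.
rewrite mulr_suml; apply: ler_sum => j _.
have -> : (2 ^ (n - j))%:R = 2 ^+ n / 2 ^+ j :> R.
  by rewrite natrX exprB ?unitfE ?pnatr_eq0 // -ltnS.
by rewrite natrX; apply: le_of_eq; ring.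
Qed.

End dyadic.

Section stable.
Context (R : realType).

(** The upper half of Khintchine's inequality: [powR_le_split] is applied to the
    square of the sum, with its mean A as threshold. *)
Lemma signs_moment_le (I : finType) (p : R) (x : I -> R) : 0 < p -> p <= 2 ->
  \sum_(w : {ffun I -> bool}) `|\sum_i x i * (-1) ^+ (w i)| `^ p <=
  2 * #|{ffun I -> bool}|%:R * (\sum_i x i ^+ 2) `^ (p / 2).
Proof.
move=> p0 p2; set A := \sum_i x i ^+ 2.
have A0 : 0 <= A by apply: sumr_ge0 => i _; exact: sqr_ge0.
have th1 : p / 2 <= 1 by rewrite ler_pdivrMr // mul1r.
have th0 : 0 < p / 2 by rewrite divr_gt0.
have E (w : {ffun I -> bool}) : `|\sum_i x i * (-1) ^+ (w i)| `^ p =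
    ((\sum_i x i * (-1) ^+ (w i)) ^+ 2) `^ (p / 2).
  rewrite -[in RHS]real_normK ?num_real // -powR_mulrn // -powRrM.
  by congr (_ `^ _); field.
move: A0; rewrite le_eqVlt => /predU1P[A0|A0].
  rewrite big1 ?mulr_ge0 ?powR_ge0 // => w _.
  rewrite big1 ?normr0 ?powR0 ?gt_eqF // => i _.
  have : x i ^+ 2 <= 0.
    by rewrite A0 /A (bigD1 i) //= lerDl; apply: sumr_ge0 => j _; exact: sqr_ge0.
  by rewrite le_eqVlt ltNge sqr_ge0 orbF sqrf_eq0 => /eqP ->; rewrite mul0r.
apply: (@le_trans _ _ (\sum_(w : {ffun I -> bool})
   (A `^ (p / 2) + (\sum_i x i * (-1) ^+ (w i)) ^+ 2 / A `^ (1 - p / 2)))).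
  apply: ler_sum => w _; rewrite E.
  have := powR_le_split (sqr_ge0 (\sum_i x i * (-1) ^+ (w i))) th0 th1 A0.
  by rewrite (powRr1 (sqr_ge0 _)).
rewrite big_split /= -mulr_suml sum_signs_sqr sumr_const -/A.
have -> : #|{ffun I -> bool}|%:R * A / A `^ (1 - p / 2) = #|{ffun I -> bool}|%:R * A `^ (p / 2).
  rewrite -mulrA; congr (_ * _); apply: (canLR (mulfK _)); first by rewrite gt_eqF ?powR_gt0.
  by rewrite -powRD ?subrKC ?(powRr1 (ltW A0)) // (gt_eqF A0) implybT.
by rewrite -mulr_natl; apply: le_of_eq; ring.
Qed.

Definition stable_level (r : R) n (i : 'I_(2 ^ n))
    (t : 'I_(2 ^ n) * {ffun 'I_(2 ^ n) -> bool}) : R :=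
  (-1) ^+ (t.2 i) * (dyadic_proximity i t.1 n)%:R `^ r^-1.

(** The mean over the signs turns the sum into a square function of y.
    [square_sum_le] makes this additive in i, and the contribution of each i is
    summed over the dyadic scales of the proximity.  The argument is that of
    the weak-type estimate for r-stable variables, whose truncations have
    controlled moments of order 2 below the threshold and p above it. *)
Lemma stable_level_le (r p : R) : 0 < p -> p < r -> r < 2 ->
  exists C : R, forall n (a : 'I_(2 ^ n) -> R), \sum_i `|a i| `^ r <= 1 ->
    \sum_t `|\sum_i a i * stable_level r i t| `^ p <=
      C * #|(('I_(2 ^ n) * {ffun 'I_(2 ^ n) -> bool})%type : finType)|%:R.
Proof.
move=> p0 pr r2; have r0 := lt_trans p0 pr.
set C0 := 4 / (1 - (2 `^ Num.min (2 / r - 1) (1 - p / r))^-1).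
exists (2 * (1 + C0)) => n a ha.
have C00 : 0 <= C0.
  have := @sum_min_power_le _ r p p0 pr r2 1 0 ler01.
  by rewrite big_ord0 mulr1.
set Om := #|{ffun 'I_(2 ^ n) -> bool}|.
pose b i := `|a i| `^ r.
have b0 i : 0 <= b i by exact: powR_ge0.
apply: (@le_trans _ _ (\sum_(y < 2 ^ n) 2 * Om%:R *
    (1 + \sum_i min_power r p (b i * (dyadic_proximity i y n)%:R)))).
  rewrite -(pair_bigA _ (fun y w => `|\sum_i a i * stable_level r i (y, w)| `^ p)) /=.
  apply: ler_sum => y _.
  apply: le_trans (_ : _ <= 2 * Om%:R *
      (\sum_i (a i * (dyadic_proximity i y n)%:R `^ r^-1) ^+ 2) `^ (p / 2)) _.
    have := @signs_moment_le _ p (fun i => a i * (dyadic_proximity i y n)%:R `^ r^-1)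
      p0 (ltW (lt_trans pr r2)).
    apply: le_trans; apply: le_of_eq.
    apply: eq_bigr => w _; congr (`|_| `^ _); apply: eq_bigr => i _.
    by rewrite /stable_level /= mulrA mulrAC.
  rewrite ler_wpM2l ?mulr_ge0 //.
  apply: le_trans (square_sum_le p0 pr r2
      (w := fun i => b i * (dyadic_proximity i y n)%:R) _); last first.
    by move=> i; rewrite mulr_ge0.
  apply: le_of_eq; congr (_ `^ _); apply: eq_bigr => i _.
  rewrite powRM // /b -powRrM mulrCA mulfV ?gt_eqF // mulr1 powR_mulrn // real_normK ?num_real //.
  by rewrite exprMn [2 / r]mulrC powRrM powR_mulrn ?powR_ge0.
rewrite card_prod card_ord natrM -mulr_sumr big_split /= sumr_const card_ord exchange_big /=.
rewrite -/Om [leRHS](_ : _ = 2 * Om%:R * ((1 + C0) * (2 ^ n)%:R)); last by ring.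
rewrite ler_wpM2l ?mulr_ge0 // mulrDl mul1r lerD2l.
apply: (@le_trans _ _ (\sum_i C0 * b i * (2 ^ n)%:R)).
  by apply: ler_sum => i _; exact: sum_min_power_proximity_le.
rewrite -mulr_suml -mulr_sumr ler_wpM2r // -[leRHS]mulr1 ler_wpM2l //.
Qed.

Lemma stable_level_ge (r p c B : R) n (t : 'I_(2 ^ n) * {ffun 'I_(2 ^ n) -> bool}) :
  0 < r -> r <= p -> 0 <= c -> 2 * B <= c `^ p * n%:R ->
  (2 ^ n)%:R * B <= \sum_(i < 2 ^ n) (c * `|stable_level r i t|) `^ p.
Proof.
move=> r0 rp c0 HB; case: t => y w.
apply: (@le_trans _ _ (c `^ p * (\sum_(i < 2 ^ n) dyadic_proximity i y n)%:R)).
  rewrite -(ler_pM2l (ltr0n R 2)).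
  have := sum_dyadic_proximity_ge n y; rewrite -(ler_nat R) 2!natrM => H.
  apply: le_trans (_ : _ <= c `^ p * ((2 ^ n)%:R * n.+1%:R)) _; last first.
    by rewrite [leRHS]mulrCA ler_wpM2l ?powR_ge0.
  rewrite mulrCA [leRHS]mulrCA ler_wpM2l //; apply: le_trans HB _.
  by rewrite ler_wpM2l ?powR_ge0 // ler_nat.
rewrite natr_sum mulr_sumr; apply: ler_sum => i _.
rewrite /stable_level normrM normr_sign mul1r ger0_norm ?powR_ge0 // powRM ?powR_ge0 //.
rewrite ler_wpM2l ?powR_ge0 // -powRrM.
apply: le1r_powR; first by rewrite ler1n dyadic_proximity_gt0.
by rewrite mulrC ler_pdivlMr // mul1r.
Qed.

End stable.

(** * The operator for each pair of exponents *)

Section from_finite.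
Context (R : realType) (r gamma rho : R).
Hypothesis r1 : 1 <= r.
Hypothesis rho0 : 0 < rho.
Local Notation mu := (@lebesgue_measure R).
Local Notation Lr := (Lfun mu r%:E).
Local Notation N f := (fine ('N[mu]_(r%:E)[EFin \o f])).

Context (I T : nat -> finType) (t0 : forall k, T k).
Context (G : forall k, I k -> T k -> R) (h : forall k, I k -> measurableTypeR R -> R).
Context (n : forall k, I k -> nat).
Hypothesis I0 : forall k, (0 < #|I k|)%N.
Hypothesis mh : forall k i, measurable_fun setT (h (k := k) i).
Hypothesis hn : forall k i x, `|h (k := k) i x| <= \1_(unit_itv (n i)) x.
Hypothesis n_inj : forall k k' i i', k != k' -> n (k := k) i != n (k := k') i'.
Hypothesis h_orthn : forall k i i', pairing (h (k := k) i) (h i') = (i == i')%:R.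
Hypothesis pairing_le : forall k (f : R -> R), f \in Lr ->
  \sum_(i : I k) `|pairing (h i) f| `^ rho <= (2 * N f) `^ rho.
Hypothesis G_le : forall p : R, 0 < p -> J r gamma p ->
  exists C : R, forall k (a : I k -> R), \sum_i `|a i| `^ rho <= 1 ->
     \sum_t `|\sum_i a i * G i t| `^ p <= C * #|T k|%:R.
Hypothesis G_ge : forall p : R, 0 < p -> ~ J r gamma p -> forall B : R,
  exists k, forall t : T k,
    #|I k|%:R * B <= \sum_(i : I k) (4^-1 ^+ k.+1 * `|G i t|) `^ p.
Hypothesis J_half : J r gamma 2^-1.

(** The functionals are pairings with functions supported in unit intervals of
    the line; distinct levels use distinct intervals, which makes them
    biorthogonal.  The values of the operator live on the cells of [0, 1]. *)
Lemma sharp_of_finite_levels : exists S, sharp_operator r gamma S.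
Proof.
pose g k (i : I k) (x : R) : R := G i (cell (t0 k) x).
exists (glued h g); apply: glued_sharp => //.
- by move=> k i; exact: (measurable_cell (t0 k) (G i)).
- by move=> k i f fL; exact: (bump_integrable r1 (mh i) (hn i) fL).
- by move=> k i; exact: (bump_Lfun r1 (mh i) (hn i)).
- by move=> k i; exact: (bump_norm r1 (mh i) (hn i)).
- by move=> k k' i i' kk'; exact: (pairing_disjoint (n_inj i i' kk') (hn i) (hn i')).
- move=> p p0 Jp; have [C HC] := G_le p0 Jp.
  exists (C * 2 `^ p) => k f fL.
  have N0 : 0 <= N f by rewrite fine_ge0 // Lnorm_ge0.
  have T0 : 0 < #|T k|%:R :> R by rewrite ltr0n; apply/card_gt0P; exists (t0 k).
  pose F (t : T k) := `|\sum_i pairing (h i) f * G i t| `^ p.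
  have -> : (\int[unif R]_x (`|level h g k f x| `^ p)%:E =
             \int[unif R]_x (F (cell (t0 k) x))%:E)%E.
    by apply: eq_integral.
  rewrite unif_cell; last by move=> t; exact: powR_ge0.
  rewrite lee_fin ler_pdivrMl //.
  apply: le_trans (finite_level_homogeneous rho0 p0 (HC k) _ (pairing_le k fL)) _.
    by rewrite mulr_ge0.
  by rewrite powRM //; apply: le_of_eq; ring.
- move=> p p0 Jp B; have [k Hk] := G_ge p0 Jp B.
  by exists k; split => // x; exact: Hk.
Qed.

End from_finite.

Section instances.
Context (R : realType).

Lemma orth_indic (I : finType) (n : I -> nat) (i i' : I) : injective n ->
  pairing (\1_(@unit_itv R (n i))) (\1_(@unit_itv R (n i'))) = (i == i')%:R.
Proof.
move=> ninj; have [->|ii] := eqVneq i i'; first exact: pairing_indic.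
apply: (@pairing_disjoint R (n i) (n i')); try exact: indic_bump.
by apply: contra ii => /eqP /ninj ->.
Qed.

Definition block_index m (k : nat) (i : 'I_m) : nat := pickle (k, (i : nat)).

Lemma block_index_inj m k : injective (@block_index m k).
Proof. by move=> i i' /(pcan_inj pickleK) [] /val_inj. Qed.

Lemma block_index_neq (m m' : nat) k k' (i : 'I_m) (i' : 'I_m') :
  k != k' -> block_index k i != block_index k' i'.
Proof. by apply: contra => /eqP /(pcan_inj pickleK) [] ->. Qed.

Lemma card_ord_pow m : #|'I_(2 ^ m)| = (2 ^ m)%N. Proof. exact: card_ord. Qed.

Definition ord0_pow m : 'I_(2 ^ m) := Ordinal (expn_gt0 2 m : (0 < 2 ^ m)%N).

Lemma spikes_unbounded (q p : R) (B : R) : 0 < q -> q < p -> exists k,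
  forall t : 'I_(2 ^ (k ^ 2)), #|'I_(2 ^ (k ^ 2))|%:R * B <=
    \sum_(i : 'I_(2 ^ (k ^ 2))) (4^-1 ^+ k.+1 * `|spike q i t|) `^ p.
Proof.
move=> q0 qp; have p0 := lt_trans q0 qp.
have d0 : 0 < p / q - 1 by rewrite subr_gt0 ltr_pdivlMr // mul1r.
have [k Hk] := level_growth B p0 d0; exists k => t.
by apply: spike_ge => //; rewrite card_ord_pow.
Qed.

(** Here J = (0, gamma], and the coefficients in l^r are also in l^gamma. *)
Lemma sharp_operator_gamma_ge_r (r gamma : R) : 1 <= r -> r <= gamma ->
  exists S, sharp_operator r gamma S.
Proof.
move=> r1 rg; have r0 : 0 < r by apply: lt_le_trans r1.
have JE : J r gamma = `]0, gamma]%classic by rewrite /J rg orbT.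
apply: (@sharp_of_finite_levels R r gamma r r1 r0 (fun k => 'I_(2 ^ (k ^ 2)))
  (fun k => 'I_(2 ^ (k ^ 2))) (fun k => ord0_pow (k ^ 2)) (fun k => spike gamma)
  (fun k i => \1_(@unit_itv R (block_index k i))) (fun k i => block_index k i)).
- by move=> k; rewrite card_ord expn_gt0.
- by move=> k i; exact: (measurable_indic (measurable_unit_itv _)).
- by move=> k i x; exact: indic_bump.
- by move=> k k' i i' /block_index_neq.
- by move=> k i i'; apply: (@orth_indic _ (block_index k)); exact: block_index_inj.
- by move=> k f fL; apply: (@pairing_indic_le R r r1 _ (block_index k)) => //;
     exact: block_index_inj.
- move=> p p0; rewrite JE /= in_itv /= p0 /= => pg.
  by exists 2 => k a ha; apply: (@spike_le R _ r gamma r0 rg p a).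
- move=> p p0; rewrite JE /= in_itv /= p0 /= => /negP; rewrite -ltNge => gp B.
  exact: (spikes_unbounded B (lt_le_trans r0 rg) gp).
- rewrite JE /= in_itv /= invr_gt0 ltr0n /=; apply: le_trans rg.
  by apply: le_trans r1; rewrite invf_le1 ?ler1n.
Qed.

(** For r >= 2 the cases of J combine into (0, max(gamma, 2)].  Random
    signs are orthonormal and lie in the unit ball of every L^r of a unit
    interval, so the coefficients are in l^2 whatever the value of r, and the
    spikes can be sharp at an exponent below r. *)
Lemma sharp_operator_r_ge_2 (r gamma : R) : 2 <= r -> exists S, sharp_operator r gamma S.
Proof.
move=> r2; have r1 : 1 <= r by apply: le_trans r2; rewrite ler1n.
pose q := Num.max gamma 2.
have q2 : 2 <= q by rewrite le_max lexx orbT.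
have q0 : 0 < q by apply: lt_le_trans q2.
have JE : J r gamma = `]0, q]%classic.
  rewrite /J /q; case: (leP gamma 2) => g2.
    case: ifPn => [/orP[/andP[g2' _]|rg]|].
    - by rewrite (_ : gamma = 2) //; apply: le_anti; rewrite g2 g2'.
    - by rewrite (_ : gamma = 2) //; apply: le_anti; rewrite g2 (le_trans r2 rg).
    rewrite negb_or r2 andbT -ltNge => /andP[h gr]; case: ifPn => //.
    by rewrite -leNgt => g2'; move: h; rewrite g2' gr.
  by case: (ltP gamma r) => gr; rewrite ?orbT ?(ltW g2) /=.
apply: (@sharp_of_finite_levels R r gamma 2 r1 (ltr0n _ 2) (fun k => 'I_(2 ^ (k ^ 2)))
  (fun k => 'I_(2 ^ (k ^ 2))) (fun k => ord0_pow (k ^ 2)) (fun k => spike q)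
  (fun k i => rademacher k i) (fun k i => k)).
- by move=> k; rewrite card_ord expn_gt0.
- by move=> k i; exact: measurable_rademacher.
- by move=> k i x; exact: rademacher_bump.
- by [].
- by move=> k i i'; exact: pairing_rademacher.
- by move=> k f fL; exact: pairing_rademacher_le.
- move=> p p0; rewrite JE /= in_itv /= p0 /= => pq.
  by exists 2 => k a ha; apply: (@spike_le R _ 2 q (ltr0n _ 2) q2 p a).
- move=> p p0; rewrite JE /= in_itv /= p0 /= => /negP; rewrite -ltNge => qp B.
  exact: (spikes_unbounded B q0 qp).
- rewrite JE /= in_itv /= invr_gt0 ltr0n /=; apply: le_trans q2.
  by rewrite (@le_trans _ _ 1) ?ler1n // invf_le1 ?ler1n.
Qed.

(** Here J = (0, r) omits its endpoint: at p = r the stable variables on 2^n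
    points have r-th powers of mean at least (n+1) / 2 over i.  The parameter
    n = 2^(k^2) makes this outgrow 4^(k+1). *)
Lemma sharp_operator_gamma_lt_r (r gamma : R) : 1 <= r -> gamma < r -> r < 2 ->
  exists S, sharp_operator r gamma S.
Proof.
move=> r1 gr r2; have r0 : 0 < r by apply: lt_le_trans r1.
have JE : J r gamma = `]0, r[%classic.
  by rewrite /J (leNgt 2 gamma) (lt_trans gr r2) (leNgt r gamma) gr (leNgt 2 r) r2.
pose m k := (2 ^ (k ^ 2))%N.
apply: (@sharp_of_finite_levels R r gamma r r1 r0 (fun k => 'I_(2 ^ m k))
  (fun k => ('I_(2 ^ m k) * {ffun 'I_(2 ^ m k) -> bool})%type)
  (fun k => (ord0_pow (m k), [ffun=> false])) (fun k => @stable_level R r (m k))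
  (fun k i => \1_(@unit_itv R (block_index k i))) (fun k i => block_index k i)).
- by move=> k; rewrite card_ord expn_gt0.
- by move=> k i; exact: (measurable_indic (measurable_unit_itv _)).
- by move=> k i x; exact: indic_bump.
- by move=> k k' i i' /block_index_neq.
- by move=> k i i'; apply: (@orth_indic _ (block_index k)); exact: block_index_inj.
- by move=> k f fL; apply: (@pairing_indic_le R r r1 _ (block_index k)) => //;
     exact: block_index_inj.
- move=> p p0; rewrite JE /= in_itv /= p0 /= => pr.
  by have [C HC] := stable_level_le p0 pr r2; exists C => k a; exact: HC.
- move=> p p0; rewrite JE /= in_itv /= p0 /= => /negP; rewrite -leNgt => rp B.
  have [k Hk] := level_growth (2 * B) p0 ltr01; exists k => t.
  rewrite card_ord; apply: stable_level_ge => //.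
  by move: Hk; rewrite powRr1.
- rewrite JE /= in_itv /= invr_gt0 ltr0n /=; apply: lt_le_trans r1.
  by rewrite invf_lt1 ?ltr1n.
Qed.

Lemma exists_sharp_operator (r gamma : R) : 1 <= r ->
  exists S, sharp_operator r gamma S.
Proof.
move=> r1; have [r2|r2] := leP 2 r; first exact: sharp_operator_r_ge_2.
have [rg|gr] := leP r gamma; first exact: sharp_operator_gamma_ge_r.
exact: sharp_operator_gamma_lt_r.
Qed.

End instances.

Unset Implicit Arguments.

Theorem corollary6p8 (R : realType) (d : nat) (r gamma : 'I_d -> R) :
  (2 <= d)%N -> (forall j, 1 <= r j) -> (forall j, 0 < gamma j) ->
  exists (G : 'I_d -> haar_group R) (dX : measure_display)
    (X : measurableType dX) (mu : {sigma_finite_measure set X -> \bar R})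
    (T : forall j : 'I_d, (G j -> R) -> (X -> R)),
    let S := bounded_exponents r gamma mu T in
    [/\ forall j, G j = circle_group R \/ G j = real_line_group R,
        forall j, linear_operator (r j) mu (T j),
        multilinear_bound r gamma mu T,
        S = [set p | forall j, J (r j) (gamma j) (p j)]
              `&` exponent_hyperplane gamma
      & (S !=set0 <->
           ((exists j, r j < 2) ->
              \sum_(j < d) gamma j / Num.min (r j) 2 < 1) /\
           ((forall j, 2 <= r j) -> \sum_(j < d) gamma j <= 2))
        /\
        (S !=set0 ->
           S = [set p | forall j, if r j < 2 then 0 < p j < r j
                                  else 0 < p j <= 2]
                 `&` exponent_hyperplane gamma)].
Proof.
move=> d2 r1 g0.
have /boolp.choice[S HS] : forall j, exists S, sharp_operator (r j) (gamma j) S.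
  by move=> j; exact: exists_sharp_operator.
have [dX [X [mu [pi [mpi Hpi]]]]] := product_space R d.
exists (fun=> real_line_group R), dX, X, mu, (fun j f x => S j f (pi j x)).
have SE : bounded_exponents (G := fun=> real_line_group R) r gamma mu
     (fun j f x => S j f (pi j x)) =
   [set p | forall j, J (r j) (gamma j) (p j)] `&` exponent_hyperplane gamma.
  rewrite /bounded_exponents setIC; apply/seteqP; split => p /= [Hp ph]; split => // j.
    have [p0 _] := ph; apply: contrapT => nJ.
    exact: (product_operator_unbounded HS mpi (p0 j) nJ (Hp j)).
  have [p0 _] := ph.
  exact: (product_operator_bounded HS Hpi (p0 j) (Hp j)).
split.
- by right.
- by move=> j; exact: (product_operator_linear r1 HS mpi Hpi).
- exact: (product_operator_multilinear g0 HS Hpi).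
- exact: SE.
- rewrite SE; split; first exact: J_hyperplane_nonempty.
  exact: J_hyperplane_eq.
Qed.
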